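(* Let $j>0$ and $u\in L^\infty([0,1],\mathbb R_+)$ with $F(0;u)>0$. Then: (i) $F(0;S^{(\delta,\pm)}_t(u))=F(0;u)$ for all $\delta>0$ with $F(0;u)>j\delta$ and all $t\in\delta\mathbb N$. (ii) There is a constant $c$ such that for every $\delta>0$ with $F(0;u)>j\delta$: $\|S^{(\delta,+)}_t(u)\|_\infty\le c(j+\|u\|_\infty)$ for all $t\in\delta\mathbb N$ with $t\le1$, and $\|S^{(\delta,+)}_t(u)\|_\infty\le c(j+F(0;u))$ for all $t\in\delta\mathbb N$ with $t>1$; the same bounds hold for the density $S^{(\delta,-)}_t(u)-j\delta D_0$. (iii) Given any $\sigma>0$: for every $\zeta>0$ there are $\tau_\zeta>0$ and $d_\zeta>0$ such that for every $\delta\in(0,\sigma)$ with $F(0;u)>j\delta$, every $t\ge\sigma$ in $\delta\mathbb N$, every $t'\in\delta\mathbb N\cap(t,t+\tau_\zeta)$ and every $r,r'\in[0,1]$ with $|r-r'|<d_\zeta$, $$|S^{(\delta,+)}_t(u)(r)-S^{(\delta,+)}_t(u)(r')|<\zeta,\qquad |S^{(\delta,+)}_{t'}(u)(r)-S^{(\delta,+)}_t(u)(r)|<\zeta.$$ (iv) For all $\delta>0$ with $F(0;u)>j\delta$ and all $t>0$ in $\delta\mathbb N$, $F\big(0;|S^{(\delta,+)}_t(u)-S^{(\delta,-)}_t(u)|\big)\le4j\delta$.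
   Context: For a positive measure $\mu$ on $[0,1]$, $F(r;\mu)=\mu([r,1])$. $\mathcal U$ = measures $c_uD_0+\rho_u(r)dr$ ($c_u\ge0$, $\rho_u\in L^\infty([0,1],\mathbb R_+)$, $D_0$ Dirac mass at $0$); for $u,v\in\mathcal U$, $|u-v|=|c_u-c_v|D_0+|\rho_u-\rho_v|$, so $F(0;|u-v|)$ is the total variation of $u-v$. $K^{(\delta)}u=j\delta D_0+\mathbf 1_{[0,R_\delta(u)]}u$ with $R_\delta(u)=\inf\{r:F(r;u)=j\delta\}$ (for $F(0;\rho_u)>j\delta$). $G^{\rm neum}_t(r,r')$ is the Neumann heat kernel of $\partial_t=\frac12\partial_r^2$ on $[0,1]$ ($\sum_kG_t(r,r'_k)$, $G_t(r,r')=e^{-(r-r')^2/2t}/\sqrt{2\pi t}$, $r'_k$ images of $r'$ under repeated reflections of $[0,1]$); $G^{\rm neum}_t*\mu(r)=\int G^{\rm neum}_t(r,r')\mu(dr')$. Barriers: $S^{(\delta,\pm)}_0(u)=u$, $S^{(\delta,-)}_{n\delta}(u)=K^{(\delta)}G^{\rm neum}_\delta*S^{(\delta,-)}_{(n-1)\delta}(u)$, $S^{(\delta,+)}_{n\delta}(u)=G^{\rm neum}_\delta*K^{(\delta)}S^{(\delta,+)}_{(n-1)\delta}(u)$; for $n\ge1$, $S^{(\delta,+)}_{n\delta}(u)$ is a bounded continuous function and $S^{(\delta,-)}_{n\delta}(u)-j\delta D_0$ is a bounded density. *)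

(* Defs.v *)
From HB Require Import structures.
From mathcomp Require Import all_boot all_order all_algebra.
From mathcomp Require Import all_classical all_reals all_analysis.
Set Implicit Arguments. Unset Strict Implicit. Unset Printing Implicit Defensive.
Import Order.TTheory GRing.Theory Num.Theory.
Import numFieldNormedType.Exports.
Local Open Scope classical_set_scope.
Local Open Scope ring_scope.

(* Elements of U: c D_0 + rho(r) dr, rho considered on [0,1]. *)
Record meas (R : realType) := Meas { atom : R ; dens : R -> R }.


(* F(r; mu) = mu([r,1]) ; the atom at 0 belongs to [r,1] iff r <= 0. *)
Definition Fm (R : realType) (r : R) (mu : meas R) : \bar R :=
  ((if r <= 0 then atom mu else 0)%:E +
   \int[(@lebesgue_measure R)]_(x in `[r, 1%R] `&` `[0%R, 1%R]) (dens mu x)%:E)%E.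

Definition totvar (R : realType) (mu nu : meas R) : \bar R :=
  ((`|atom mu - atom nu|)%:E +
   \int[(@lebesgue_measure R)]_(x in `[0%R, 1%R]) (`|dens mu x - dens nu x|)%:E)%E.

Definition normInf (R : realType) (f : R -> R) : \bar R :=
  ereal_inf [set M : \bar R | {ae (@lebesgue_measure R), forall x, `[0%R, 1%R]%classic x -> ((`|f x|)%:E <= M)%E}].

Definition Gk (R : realType) (t r r' : R) : R :=
  expR (- (r - r') ^+ 2 / (2 * t)) / Num.sqrt (2 * pi * t).

(* Neumann heat kernel on [0,1]: sum over the images r' + 2k and -r' + 2k, k in Z *)
Definition Gneum (R : realType) (t r r' : R) : R :=
  fine (\esum_(k in [set: int])
          ((Gk t r (r' + 2 * k%:~R))%:E + (Gk t r (2 * k%:~R - r'))%:E))%E.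

Definition heat (R : realType) (t : R) (mu : meas R) : meas R :=
  Meas 0 (fun r => if (0 <= r) && (r <= 1) then
     atom mu * Gneum t r 0 +
     fine (\int[(@lebesgue_measure R)]_(x in `[0%R, 1%R]) (Gneum t r x * dens mu x)%:E)%E
   else 0).

Definition Rdel (R : realType) (j delta : R) (mu : meas R) : R :=
  inf [set r : R | Fm r mu = (j * delta)%:E].

Definition Kop (R : realType) (j delta : R) (mu : meas R) : meas R :=
  Meas (j * delta + atom mu)
       (fun r => if (0 <= r) && (r <= Rdel j delta mu) then dens mu r else 0).

Fixpoint Sminus (R : realType) (j delta : R) (n : nat) (u : meas R) : meas R :=
  match n with
  | 0 => u
  | n.+1 => Kop j delta (heat delta (Sminus j delta n u))
  end.

Fixpoint Splus (R : realType) (j delta : R) (n : nat) (u : meas R) : meas R :=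
  match n with
  | 0 => u
  | n.+1 => heat delta (Kop j delta (Splus j delta n u))
  end.

Definition ofFun (R : realType) (u : R -> R) : meas R := Meas 0 u.

(* Main.v *)
Require Import Defs.
From HB Require Import structures.
From mathcomp Require Import all_boot all_order all_algebra.
From mathcomp Require Import all_classical all_reals all_analysis.
From mathcomp Require Import measurable_realfun.
From mathcomp Require Import ring lra.
Import Order.TTheory GRing.Theory Num.Theory.
Import numFieldNormedType.Exports.
Local Open Scope classical_set_scope.
Local Open Scope ring_scope.
Set Implicit Arguments.
Unset Strict Implicit.
Unset Printing Implicit Defensive.

(* Reflecting through 0 and 1 unfolds [0,1] onto the line and reduces the Neumann kernel to the
   Gaussian one; this gives its mass, its semigroup property, a bound [A / sqrt t] for small t and,
   by the semigroup property, sup and Lipschitz bounds uniform in t >= e. One step of either scheme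
   moves a mass j*delta, and a displacement that then diffuses for a time k*delta changes the
   density by at most A*j*delta / sqrt (k*delta); summing over k, the scheme run for a time e stays
   within 2*A*j*sqrt e of the pure heat flow of a measure of the same mass. Bounds and
   equicontinuity follow by restarting the scheme a time e before t. Both K and the heat flow
   contract the total variation and K moves a measure by exactly 2*j*delta; since
   S+_n u = G * S-_(n-1) (K u), this compares S+ and S-. *)

(** * Folding the line onto the unit interval *)

Definition zenum (n : nat) : int := if odd n then Negz n./2 else Posz n./2.

Lemma zenum_bij : set_bij [set: nat] [set: int] zenum.
Proof.
rewrite /zenum; split => //.
- move=> m n _ _ /=; move: (odd_double_half m) (odd_double_half n).
  by case: (odd m); case: (odd n) => // hm hn [h]; rewrite -hm -hn h.
- case=> k _ /=; first by exists k.*2; rewrite // odd_double doubleK.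
  by exists k.*2.+1; rewrite //= odd_double/= uphalf_double.
Qed.

Lemma leq_zenum n : (n <= 2 * `|zenum n|)%N.
Proof.
rewrite /zenum -{1}(odd_double_half n) -mul2n.
by case: ifP => on /=; rewrite ?mulnS ?leq_add2r ?addSn ?add0n.
Qed.

Lemma esum_zenum (R : realType) (a : int -> \bar R) : (forall k, 0 <= a k)%E ->
  (\esum_(k in [set: int]) a k = \sum_(n <oo) a (zenum n))%E.
Proof.
by move=> a0; rewrite (@reindex_esum _ _ _ _ _ zenum _ zenum_bij) nneseries_esumT.
Qed.

Section lebesgue_isometries.
Context {R : realType}.
Local Notation mu := (@lebesgue_measure R).
Local Open Scope ereal_scope.

Lemma lebesgue_measure_shift (c : R) (A : set R) : measurable A ->
  pushforward mu (fun x : R => (x + c)%R : measurableTypeR R) A = mu A.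
Proof.
move=> mA.
have mphi : measurable_fun setT (fun x : R => (x + c)%R : measurableTypeR R).
  by apply: measurable_funD.
pose phi : {mfun R >-> measurableTypeR R} := HB.pack (fun x : R => (x + c)%R : measurableTypeR R) (isMeasurableFun.Build _ _ _ _ _ mphi).
apply/esym.
apply: (@lebesgue_measure_unique R (pushforward mu phi)) => //= _ [[a b]] _ <-.
rewrite /pushforward.
have -> : (fun x : R => (x + c)%R) @^-1` `]a, b] = `](a - c)%R, (b - c)%R]%classic.
  by apply/seteqP; split=> x /=; rewrite !in_itv/= ltrBlDr lerBrDr.
rewrite !lebesgue_measure_itv/= !lte_fin ltrD2r.
by case: ifP => // _; rewrite -!EFinB; congr (_%:E); ring.
Qed.

Lemma ge0_integral_shift (c : R) (D : set R) (f : R -> \bar R) :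
  measurable D -> measurable_fun D f -> (forall x, 0 <= f x) ->
  \int[mu]_(x in D) f x = \int[mu]_(x in (fun x => (x + c)%R) @^-1` D) f (x + c)%R.
Proof.
move=> mD mf f0.
have mphi : measurable_fun setT (fun x : R => (x + c)%R : measurableTypeR R).
  by apply: measurable_funD.
rewrite -[RHS](@ge0_integral_pushforward _ _ (measurableTypeR R) (measurableTypeR R) R _ mphi mu D f mD mf); last by move=> y _; exact: f0.
by apply: eq_measure_integral => //= A mA AS; exact/esym/lebesgue_measure_shift.
Qed.

Lemma ge0_integral_reflect (c : R) (D : set R) (f : R -> \bar R) :
  measurable D -> measurable_fun D f -> (forall x, 0 <= f x) ->
  \int[mu]_(x in D) f x = \int[mu]_(x in (fun x => (c - x)%R) @^-1` D) f (c - x)%R.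
Proof.
move=> mD mf f0.
rewrite (ge0_integral_shift c)//.
have mphi : measurable_fun setT (fun x : R => (x + c)%R : measurableTypeR R).
  by apply: measurable_funD.
have mphi' : measurable_fun setT (fun x : R => (- x)%R : measurableTypeR R).
  by apply: measurableT_comp.
have mD' : measurable ((fun x => (x + c)%R) @^-1` D).
  by rewrite -[X in measurable X]setTI; exact: mphi.
have mf' : measurable_fun ((fun x => (x + c)%R) @^-1` D) (fun x => f (x + c)%R).
  apply: (@measurable_comp _ _ _ _ _ _ D) => //.
    by move=> _ /= [x Dx <-].
  exact: measurable_funS mphi.
have -> : (fun x => (c - x)%R) @^-1` D = (fun x : R => (- x)%R) @^-1` ((fun x => (x + c)%R) @^-1` D).
  by apply/seteqP; split=> x /=; rewrite addrC.
under [RHS]eq_integral do rewrite addrC.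
rewrite -[RHS](@ge0_integral_pushforward _ _ (measurableTypeR R) (measurableTypeR R) R _ mphi' mu _ _ mD' mf'); last by move=> y _; exact: f0.
by apply: eq_measure_integral => //= A mA AS; exact/esym/lebesgue_measureN.
Qed.

(* The period cells [2k-1, 2k+1[ tile the line, and each is folded onto [0,1]. *)
Lemma ge0_integral_fold (f : R -> \bar R) :
  measurable_fun setT f -> (forall x, 0 <= f x) ->
  \int[mu]_x f x =
  \int[mu]_(x in `[0%R, 1%R]) \esum_(k in [set: int])
    (f (x + 2 * k%:~R)%R + f (2 * k%:~R - x)%R).
Proof.
move=> mf f0; have ebij := zenum_bij; pose e := zenum.
pose F n : set R := `[(2 * (e n)%:~R - 1)%R, (2 * (e n)%:~R + 1)%R[%classic.
have FT : \bigcup_n F n = setT.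
  apply/seteqP; split=> // x _.
  pose k := Num.floor ((x + 1) / 2)%R.
  have [_ _ /(_ k I)[n _ enk]] := ebij; exists n => //.
  rewrite /F/= in_itv/= /e enk /k.
  have := floor_le_tmp ((x + 1) / 2)%R; have := floorD1_gt ((x + 1) / 2)%R.
  rewrite intrD; lra.
have Ftriv : trivIset setT F.
  apply/trivIsetP => m n _ _ mn; apply/seteqP; split=> // x [].
  rewrite /F/= !in_itv/= => /andP[a b] /andP[c d].
  move/eqP: mn; apply; have [_ inj _] := ebij; apply: inj; rewrite ?inE//.
  have h1 : ((e m)%:~R < (e n + 1)%:~R :> R)%R by rewrite intrD; lra.
  have h2 : ((e n)%:~R < (e m + 1)%:~R :> R)%R by rewrite intrD; lra.
  by move: h1 h2; rewrite !ltr_int !ltzD1 => h1 h2; apply/le_anti; rewrite h1 h2.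
have mFf (D : set R) g : measurable_fun setT g -> measurable_fun D (g : R -> \bar R).
  exact: measurable_funS.
rewrite -FT ge0_integral_bigcup//; [|by move=> n; exact: measurable_itv|exact: mFf].
have cell (k : int) : \int[mu]_(x in `[(2 * k%:~R - 1)%R, (2 * k%:~R + 1)%R[) f x =
    \int[mu]_(x in `[0%R, 1%R]) (f (x + 2 * k%:~R)%R + f (2 * k%:~R - x)%R).
  have s1 : measurable_fun setT (fun x : R => f (x + 2 * k%:~R)%R).
    by apply: (measurableT_comp mf); apply: measurable_funD.
  have s2 : measurable_fun setT (fun x : R => f (2 * k%:~R - x)%R).
    by apply: (measurableT_comp mf); apply: measurable_funB.
  rewrite ge0_integralD//; [|exact: mFf|exact: mFf].
  rewrite (@itv_bndbnd_setU _ _ _ (BLeft (2 * k%:~R)%R)) ?bnd_simp; [|lra|lra].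
  rewrite ge0_integral_setU//=; [|exact: mFf|]; last first.
    rewrite disj_set2E; apply/eqP/seteqP; split=> // x [] /=; rewrite !in_itv/=; lra.
  rewrite [X in X + _ = _](ge0_integral_reflect (2 * k%:~R)%R)//; last exact: mFf.
  rewrite [X in _ + X = _](ge0_integral_shift (2 * k%:~R)%R)//; last exact: mFf.
  rewrite addeC; congr (_ + _).
    rewrite -(integral_itv_bndo_bndc (r := 1%R))//; last exact: mFf.
    congr (integral _ _ _); apply/seteqP; split=> x /=; rewrite !in_itv/=; lra.
  rewrite -(integral_itv_obnd_cbnd (r := 0%R))//; last exact: mFf.
  congr (integral _ _ _); apply/seteqP; split=> x /=; rewrite !in_itv/=; lra.
rewrite (eq_eseriesr (fun n _ => cell (e n))) -integral_nneseries//; last 2 first.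
- move=> n; apply: mFf; apply: emeasurable_funD.
    by apply: (measurableT_comp mf); apply: measurable_funD.
  by apply: (measurableT_comp mf); apply: measurable_funB.
- by move=> n x _; rewrite adde_ge0.
apply: eq_integral => x _.
rewrite esum_zenum// => n; by rewrite adde_ge0.
Qed.

End lebesgue_isometries.

(** * Gaussian kernel *)

Section gaussian.
Context {R : realType}.
Implicit Types (s t r x y z a b : R).
Local Notation mu := (@lebesgue_measure R).

Lemma Gk_ge0 t r x : 0 <= Gk t r x.
Proof. by rewrite divr_ge0 ?expR_ge0 ?sqrtr_ge0. Qed.

Lemma GkC t r x : Gk t r x = Gk t x r.
Proof. by rewrite /Gk -opprB sqrrN. Qed.

Lemma GkD t r x c : Gk t (r + c) (x + c) = Gk t r x.
Proof. by rewrite /Gk (_ : r + c - (x + c) = r - x)//; ring. Qed.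

Lemma GkN t r x : Gk t (- r) (- x) = Gk t r x.
Proof. by rewrite /Gk (_ : - r - - x = - (r - x)) ?sqrrN//; ring. Qed.

Lemma measurable_Gk t d (T : measurableType d) (D : set T) (f g : T -> R) :
  measurable_fun D f -> measurable_fun D g ->
  measurable_fun D (fun w => Gk t (f w) (g w)).
Proof.
move=> mf mg; apply: measurable_funM => //.
apply: measurableT_comp => //; apply: measurable_funM => //.
apply: measurableT_comp => //; apply: measurable_funX.
exact: measurable_funB.
Qed.

Lemma Gk_normal_pdf t r x : 0 < t -> Gk t r x = normal_pdf r (Num.sqrt t) x.
Proof.
move=> t0; have st0 : Num.sqrt t != 0 by rewrite gt_eqF// sqrtr_gt0.
rewrite GkC normal_pdfE// /Gk /normal_peak /normal_fun sqr_sqrtr ?ltW// mulrC.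
have -> : t * pi *+ 2 = 2 * pi * t by ring.
by have -> : t *+ 2 = 2 * t by ring.
Qed.

Lemma integral_Gk t r : 0 < t -> (\int[mu]_x (Gk t r x)%:E = 1)%E.
Proof.
move=> t0; rewrite -(integral_normal_pdf r (Num.sqrt t)).
by apply: eq_integral => x _; rewrite Gk_normal_pdf.
Qed.

Lemma Gk_mul s t a b y : 0 < s -> 0 < t ->
  Gk s a y * Gk t y b =
  Gk (s + t) a b * Gk (s * t / (s + t)) ((t * a + s * b) / (s + t)) y.
Proof.
move=> s0 t0; have st0 : 0 < s + t by exact: addr_gt0.
have M (p q c d : R) : 0 <= c -> expR p / Num.sqrt c * (expR q / Num.sqrt d) =
    expR (p + q) / Num.sqrt (c * d).
  by move=> c0; rewrite mulrACA expRD sqrtrM// invfM.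
rewrite /Gk !M ?mulr_ge0 ?pi_ge0 ?ltW//.
congr (expR _ / Num.sqrt _); field; rewrite !gt_eqF//.
Qed.

Lemma integral_GkM s t a b : 0 < s -> 0 < t ->
  (\int[mu]_y ((Gk s a y)%:E * (Gk t y b)%:E) = (Gk (s + t) a b)%:E)%E.
Proof.
move=> s0 t0.
under eq_integral do rewrite -EFinM Gk_mul// EFinM.
rewrite ge0_integralZl//.
- by rewrite integral_Gk ?mule1// divr_gt0 ?mulr_gt0 ?addr_gt0.
- by apply/measurable_EFinP; apply: measurable_Gk.
- by move=> y _; rewrite lee_fin Gk_ge0.
- by rewrite lee_fin Gk_ge0.
Qed.

Lemma Gk_double t r x : 0 < t ->
  Gk t r x = Num.sqrt 2 * expR (- (r - x) ^+ 2 / (4 * t)) * Gk (2 * t) r x.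
Proof.
move=> t0; rewrite /Gk (_ : 2 * pi * (2 * t) = 2 * (2 * pi * t)); last by ring.
rewrite [Num.sqrt (2 * _)]sqrtrM//.
have -> : - (r - x) ^+ 2 / (2 * t) =
    - (r - x) ^+ 2 / (4 * t) + - (r - x) ^+ 2 / (2 * (2 * t)).
  by field; rewrite gt_eqF.
rewrite expRD.
have : Num.sqrt (2 : R) != 0 by rewrite gt_eqF ?sqrtr_gt0.
have : Num.sqrt (2 * pi * t) != 0 by rewrite gt_eqF ?sqrtr_gt0// !mulr_gt0 ?pi_gt0.
move: (Num.sqrt (2 * pi * t)) (Num.sqrt 2) (expR _) (expR _) => a b c d a0 b0.
by field; rewrite a0 b0.
Qed.

Lemma Gk_le_double t r x : 0 < t -> Gk t r x <= Num.sqrt 2 * Gk (2 * t) r x.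
Proof.
move=> t0; rewrite Gk_double// ler_wpM2r ?Gk_ge0// ler_piMr ?sqrtr_ge0//.
rewrite -expR0 ler_expR mulNr oppr_le0 divr_ge0 ?sqr_ge0// mulr_ge0// ltW//.
Qed.

(* From [y <= 1 + (y/2)^2 <= exp ((y/2)^2)] with [y = |r - x| / sqrt t]. *)
Lemma dist_Gk_le t r x : 0 < t ->
  `|r - x| * Gk t r x <= Num.sqrt (2 * t) * Gk (2 * t) r x.
Proof.
move=> t0; rewrite Gk_double// mulrA ler_wpM2r ?Gk_ge0//.
rewrite sqrtrM// mulrCA ler_wpM2l ?sqrtr_ge0//.
set z := r - x.
rewrite mulNr expRN ler_pdivrMr ?expR_gt0//.
have st0 : 0 < Num.sqrt t by rewrite sqrtr_gt0.
rewrite -ler_pdivrMl// [_^-1 * _]mulrC.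
set y := `|z| / Num.sqrt t.
have -> : z ^+ 2 / (4 * t) = (y / 2) ^+ 2.
  rewrite /y !expr_div_n real_normK ?num_real// sqr_sqrtr ?ltW//.
  by field; rewrite gt_eqF.
apply: le_trans (expR_ge1Dx _).
have := sqr_ge0 (y / 2 - 1); lra.
Qed.

Lemma Gk_lipschitz t r r' x : 0 < t -> `|r - r'| <= 1 ->
  `|Gk t r x - Gk t r' x| <=
  (2 * Num.sqrt (2 * t) + Num.sqrt 2) / (2 * t) * `|r - r'| *
    (Gk (2 * t) r x + Gk (2 * t) r' x).
Proof.
move=> t0 rr1.
wlog le : r r' rr1 / `|r - x| <= `|r' - x|.
  have [h|/ltW h] := leP `|r - x| `|r' - x| => H; first exact: H.
  by rewrite distrC [`|r - r'|]distrC [X in _ * X]addrC; apply: H => //; rewrite distrC.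
have sq : (r - x) ^+ 2 <= (r' - x) ^+ 2.
  by rewrite -(real_normK (num_real (r - x))) -(real_normK (num_real (r' - x))) ler_sqr.
have D : Gk t r' x = Gk t r x * expR (((r - x) ^+ 2 - (r' - x) ^+ 2) / (2 * t)).
  rewrite /Gk [RHS]mulrAC -expRD; congr (expR _ / _); field; rewrite gt_eqF//.
have Ge := Gk_ge0 t r x.
have c0 : 0 <= (2 * t)^-1 by rewrite invr_ge0 mulr_ge0// ltW.
rewrite ger0_norm; last first.
  by rewrite subr_ge0 D ler_piMr// -[leRHS]expR0 ler_expR mulr_le0_ge0// subr_le0.
have e1 := expR_ge1Dx (((r - x) ^+ 2 - (r' - x) ^+ 2) / (2 * t)).
have d2 : (r' - x) ^+ 2 - (r - x) ^+ 2 <= `|r - r'| * (2 * `|r - x| + 1).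
  have -> : (r' - x) ^+ 2 - (r - x) ^+ 2 = (r' - r) * (2 * (r - x) + (r' - r)) by ring.
  apply: le_trans (ler_norm _) _; rewrite normrM [`|r' - r|]distrC ler_wpM2l//.
  apply: le_trans (ler_normD _ _) _; rewrite normrM ger0_norm// lerD2l distrC//.
apply: (@le_trans _ _ (Gk t r x * ((`|r - r'| * (2 * `|r - x| + 1)) / (2 * t)))).
  rewrite D -[X in X - _]mulr1 -mulrBr ler_wpM2l//.
  move: e1; rewrite -opprB mulNr.
  have : ((r' - x) ^+ 2 - (r - x) ^+ 2) / (2 * t) <= `|r - r'| * (2 * `|r - x| + 1) / (2 * t).
    by rewrite ler_wpM2r.
  lra.
have h1 := dist_Gk_le r x t0; have h2 := Gk_le_double r x t0.
have h3 := Gk_ge0 (2 * t) r' x.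
have h0 := Gk_ge0 (2 * t) r x.
have -> : Gk t r x * (`|r - r'| * (2 * `|r - x| + 1) / (2 * t)) =
  ((2 * t)^-1 * `|r - r'|) * (2 * (`|r - x| * Gk t r x) + Gk t r x) by ring.
have -> : (2 * Num.sqrt (2 * t) + Num.sqrt 2) / (2 * t) * `|r - r'| *
    (Gk (2 * t) r x + Gk (2 * t) r' x) = ((2 * t)^-1 * `|r - r'|) *
   ((2 * Num.sqrt (2 * t) + Num.sqrt 2) * (Gk (2 * t) r x + Gk (2 * t) r' x)) by ring.
rewrite ler_wpM2l ?mulr_ge0//.
have h4 : 0 <= (2 * Num.sqrt (2 * t) + Num.sqrt 2) * Gk (2 * t) r' x.
  by rewrite mulr_ge0// addr_ge0// ?mulr_ge0 ?sqrtr_ge0.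
lra.
Qed.

End gaussian.

(** * Neumann heat kernel *)

Section neumann_kernel.
Context {R : realType}.
Implicit Types (s t r x y : R) (k : int).
Local Notation mu := (@lebesgue_measure R).
Local Notation I01 := (`[0, 1]%classic : set R).

Definition image_pair t k r x : R := Gk t r (x + 2 * k%:~R) + Gk t r (2 * k%:~R - x).

Definition eGneum t r x : \bar R := (\esum_(k in [set: int]) (image_pair t k r x)%:E)%E.

Lemma GneumE t r x : Gneum t r x = fine (eGneum t r x).
Proof. by []. Qed.

Lemma image_pair_ge0 t k r x : 0 <= image_pair t k r x.
Proof. by rewrite addr_ge0 ?Gk_ge0. Qed.

Lemma eGneumE t r x : (eGneum t r x = \sum_(n <oo) (image_pair t (zenum n) r x)%:E)%E.
Proof. by rewrite /eGneum esum_zenum// => k; rewrite lee_fin image_pair_ge0. Qed.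

Lemma eGneum_ge0 t r x : (0 <= eGneum t r x)%E.
Proof. by apply: esum_ge0 => k _; rewrite lee_fin image_pair_ge0. Qed.

Lemma measurable_image_pair t k d (T : measurableType d) (D : set T) (f g : T -> R) :
  measurable_fun D f -> measurable_fun D g ->
  measurable_fun D (fun w => image_pair t k (f w) (g w)).
Proof.
move=> mf mg; apply: measurable_funD; apply: measurable_Gk => //.
  exact: measurable_funD.
exact: measurable_funB.
Qed.

Lemma measurable_eGneum t d (T : measurableType d) (D : set T) (f g : T -> R) :
  measurable_fun D f -> measurable_fun D g ->
  measurable_fun D (fun w => eGneum t (f w) (g w)).
Proof.
move=> mf mg; under eq_fun do rewrite eGneumE.
apply: ge0_emeasurable_sum => [n w _ _|n _]; first by rewrite lee_fin image_pair_ge0.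
by apply/measurable_EFinP; exact: measurable_image_pair.
Qed.

Lemma measurable_Gneum t d (T : measurableType d) (D : set T) (f g : T -> R) :
  measurable D -> measurable_fun D f -> measurable_fun D g ->
  measurable_fun D (fun w => Gneum t (f w) (g w)).
Proof.
move=> mD mf mg; apply: measurableT_comp => //; exact: measurable_eGneum.
Qed.

Definition even_images t r : \bar R := (\esum_(k in [set: int]) (Gk t r (2 * k%:~R))%:E)%E.

Lemma even_images_shift t (c : int) r r' : r' = r + 2 * c%:~R ->
  even_images t r' = even_images t r.
Proof.
move=> ->; rewrite /even_images (@reindex_esum _ _ _ setT setT (fun k => k + c)%R); last first.
  split => [//|k l _ _ /addIr//|k _].
  by exists (k - c) => //; rewrite subrK.
by apply: eq_esum => k _; rewrite intrD mulrDr GkD.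
Qed.

Lemma even_images_opp t r r' : r' = - r -> even_images t r' = even_images t r.
Proof.
move=> ->; rewrite /even_images (@reindex_esum _ _ _ setT setT (fun k => - k)%R); last first.
  split => [//|k l _ _ /oppr_inj//|k _].
  by exists (- k) => //; rewrite opprK.
by apply: eq_esum => k _; rewrite mulrNz mulrN GkN.
Qed.

Lemma eGneum_even_images t r x :
  (eGneum t r x = even_images t (r - x) + even_images t (r + x))%E.
Proof.
rewrite /even_images -esumD; try by move=> k _; rewrite lee_fin Gk_ge0.
apply: eq_esum => k _; rewrite -EFinD /image_pair; congr (_ + _)%:E.
  by rewrite -[RHS](GkD _ _ _ x) subrK addrC.
by rewrite -[RHS](GkD _ _ _ (- x)) addrK.
Qed.

Lemma eGneumC t r x : eGneum t r x = eGneum t x r.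
Proof.
rewrite 2!eGneum_even_images; congr (_ + _)%E.
  by apply: even_images_opp; ring.
by rewrite addrC.
Qed.

Lemma eGneum_periodic t (c : int) r x : eGneum t (r + 2 * c%:~R) x = eGneum t r x.
Proof.
by rewrite 2!eGneum_even_images; congr (_ + _)%E;
  apply: (@even_images_shift _ c); ring.
Qed.

Lemma eGneum_reflect t (c : int) r x : eGneum t (2 * c%:~R - r) x = eGneum t r x.
Proof.
rewrite addrC eGneum_periodic 2!eGneum_even_images addeC.
by congr (_ + _)%E; apply: even_images_opp; ring.
Qed.

Lemma integral_eGneum t r : 0 < t -> (\int[mu]_(x in I01) eGneum t r x = 1)%E.
Proof.
move=> t0; rewrite -(integral_Gk r t0) [RHS]ge0_integral_fold//.
  by apply/measurable_EFinP; exact: measurable_Gk.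
by move=> y; rewrite lee_fin Gk_ge0.
Qed.

Definition kernel_const (T : R) : R :=
  2 / Num.sqrt (2 * pi) * (expR T^-1 / (1 - expR (- (2 * T)^-1))).

Lemma kernel_const_gt0 T : 0 < T -> 0 < kernel_const T.
Proof.
move=> T0; have p0 := @pi_gt0 R.
have q1 : 0 < 1 - expR (- (2 * T)^-1).
  by rewrite subr_gt0 -[ltRHS]expR0 ltr_expR oppr_lt0 invr_gt0 mulr_gt0.
by rewrite mulr_gt0 ?divr_gt0 ?sqrtr_gt0 ?mulr_gt0 ?expR_gt0.
Qed.

Lemma le_image_pair T t n r x : 0 < t -> t <= T -> I01 r -> I01 x ->
  image_pair t (zenum n) r x <=
  2 / (Num.sqrt (2 * pi) * Num.sqrt t) * expR T^-1 * expR (- (2 * T)^-1) ^+ n.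
Proof.
rewrite /= !in_itv/= => t0 tT /andP[r0 r1] /andP[x0 x1].
have T0 : 0 < T by exact: lt_le_trans tT.
suff H z : n%:R - 2 <= `|r - z| -> Gk t r z <=
    (Num.sqrt (2 * pi) * Num.sqrt t)^-1 * expR T^-1 * expR (- (2 * T)^-1) ^+ n.
  have zn : n%:R <= 2 * `|(zenum n)%:~R| :> R.
    by rewrite -intr_norm -natr_absz -natrM ler_nat leq_zenum.
  set W := (_^-1 * _ * _) in H.
  have -> : 2 / (Num.sqrt (2 * pi) * Num.sqrt t) * expR T^-1 *
    expR (- (2 * T)^-1) ^+ n = W + W by rewrite /W; ring.
  rewrite lerD//; apply: H.
    rewrite ler_normr; apply/orP; move: zn; set K : R := (zenum n)%:~R.
    by have [K0|K0] := ger0P K; [right|left]; lra.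
  rewrite ler_normr; apply/orP; move: zn; set K : R := (zenum n)%:~R.
  by have [K0|K0] := ger0P K; [right|left]; lra.
move=> nz; rewrite /Gk sqrtrM ?mulr_ge0 ?pi_ge0// [leLHS]mulrC -mulrA.
rewrite ler_wpM2l ?invr_ge0 ?mulr_ge0 ?sqrtr_ge0//.
rewrite -expRM_natl -expRD ler_expR mulNr.
set d := r - z in nz *.
have h1 : n%:R - 2 <= d ^+ 2.
  case: n nz => [|[|n]] nz; [have := sqr_ge0 d; lra|have := sqr_ge0 d; lra|].
  rewrite -addn2 natrD addrK in nz *.
  rewrite -real_normK ?num_real//; apply: (@le_trans _ _ (n%:R ^+ 2)).
    by rewrite -natrX ler_nat; case: (n) => // m; rewrite leq_pmulr.
  by rewrite ler_sqr ?nnegrE.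
have h2 : d ^+ 2 / (2 * T) <= d ^+ 2 / (2 * t).
  by rewrite ler_wpM2l ?sqr_ge0// lef_pV2 ?posrE ?mulr_gt0// ler_wpM2l.
have h3 : (n%:R - 2) / (2 * T) <= d ^+ 2 / (2 * T).
  by rewrite ler_wpM2r// invr_ge0 mulr_ge0// ltW.
rewrite -[leRHS]opprK lerN2; apply: le_trans h2; apply: le_trans h3.
by rewrite le_eqVlt; apply/orP; left; apply/eqP; field; rewrite gt_eqF.
Qed.

Lemma le_eGneum T t r x : 0 < t -> t <= T -> I01 r -> I01 x ->
  (eGneum t r x <= (kernel_const T / Num.sqrt t)%:E)%E.
Proof.
move=> t0 tT Ir Ix; have T0 : 0 < T by exact: lt_le_trans tT.
rewrite eGneumE; apply: lime_le.
  by apply: is_cvg_nneseries => n _ _; rewrite lee_fin image_pair_ge0.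
apply: nearW => n; rewrite sumEFin lee_fin.
have q1 : expR (- (2 * T)^-1) < 1.
  by rewrite -[ltRHS]expR0 ltr_expR oppr_lt0 invr_gt0 mulr_gt0.
apply: le_trans (ler_sum _ (fun i _ => le_image_pair i t0 tT Ir Ix)) _.
rewrite -mulr_sumr.
set q := expR (- (2 * T)^-1) in q1 *; have q0 : 0 < q by exact: expR_gt0.
have qn : \sum_(0 <= i < n) q ^+ i <= (1 - q)^-1.
  rewrite big_mkord -[leRHS]mul1r ler_pdivlMr ?subr_gt0//.
  have := subrX1 q n; have := exprn_ge0 n (ltW q0); lra.
rewrite /kernel_const -/q (_ : 2 / Num.sqrt (2 * pi) * _ / Num.sqrt t =
  2 / (Num.sqrt (2 * pi) * Num.sqrt t) * expR T^-1 * (1 - q)^-1); last first.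
  by rewrite invfM; ring.
by rewrite ler_wpM2l// mulr_ge0 ?expR_ge0// divr_ge0// mulr_ge0// sqrtr_ge0.
Qed.

Lemma eGneum_fin t r x : 0 < t -> I01 r -> I01 x -> eGneum t r x \is a fin_num.
Proof.
move=> t0 Ir Ix; rewrite ge0_fin_numE ?eGneum_ge0//.
exact: le_lt_trans (le_eGneum t0 (lexx t) Ir Ix) (ltry _).
Qed.

Lemma EFin_Gneum t r x : 0 < t -> I01 r -> I01 x -> (Gneum t r x)%:E = eGneum t r x.
Proof. by move=> t0 Ir Ix; rewrite GneumE fineK// eGneum_fin. Qed.

Lemma Gneum_ge0 t r x : 0 <= Gneum t r x.
Proof. by rewrite GneumE fine_ge0// eGneum_ge0. Qed.

Lemma GneumC t r x : Gneum t r x = Gneum t x r.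
Proof. by rewrite !GneumE eGneumC. Qed.

Lemma eGneum_semigroup s t r x : 0 < s -> 0 < t -> I01 x ->
  (\int[mu]_(y in I01) (eGneum s r y * eGneum t y x) = eGneum (s + t) r x)%E.
Proof.
move=> s0 t0 Ix.
have mG (D : set R) (f : R -> \bar R) : measurable_fun setT f -> measurable_fun D f.
  exact: measurable_funS.
have mGk : measurable_fun setT (fun y => (Gk s r y)%:E).
  by apply/measurable_EFinP; exact: measurable_Gk.
transitivity (\int[mu]_y ((Gk s r y)%:E * eGneum t y x))%E.
  rewrite [RHS]ge0_integral_fold; last 2 first.
  - by apply: emeasurable_funM => //; exact: measurable_eGneum.
  - by move=> y; rewrite mule_ge0 ?eGneum_ge0// lee_fin Gk_ge0.
  apply: eq_integral => y /[!inE] Iy.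
  rewrite -[eGneum t y x]EFin_Gneum// muleC eGneumE -nneseriesZl; last first.
    by move=> n _; rewrite lee_fin image_pair_ge0.
  rewrite esum_zenum; last first.
    by move=> k; rewrite adde_ge0// mule_ge0 ?eGneum_ge0// lee_fin Gk_ge0.
  apply: eq_eseriesr => n _; rewrite eGneum_periodic eGneum_reflect.
  by rewrite -EFin_Gneum// -!EFinM -EFinD -mulrDl mulrC.
under eq_integral.
  move=> y _; rewrite eGneumE -nneseriesZl; last first.
    by move=> n _; rewrite lee_fin image_pair_ge0.
  over.
rewrite integral_nneseries//; last 2 first.
- move=> n; apply: emeasurable_funM => //; apply/measurable_EFinP.
  exact: measurable_image_pair.
- by move=> n y _; rewrite mule_ge0 ?lee_fin ?Gk_ge0 ?image_pair_ge0.
rewrite eGneumE; apply: eq_eseriesr => n _.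
rewrite /image_pair EFinD -!integral_GkM// -ge0_integralD//.
- by apply: eq_integral => y _; rewrite EFinD muleDr.
- by move=> y _; rewrite mule_ge0 ?lee_fin ?Gk_ge0.
- by apply: emeasurable_funM => //; apply/measurable_EFinP; exact: measurable_Gk.
- by move=> y _; rewrite mule_ge0 ?lee_fin ?Gk_ge0.
- by apply: emeasurable_funM => //; apply/measurable_EFinP; exact: measurable_Gk.
Qed.

End neumann_kernel.

Section neumann_kernel_estimates.
Context {R : realType}.
Implicit Types (s t r x y : R) (k : int).
Local Notation mu := (@lebesgue_measure R).
Local Notation I01 := (`[0, 1]%classic : set R).

Lemma Gneum_le T t r x : 0 < t -> t <= T -> I01 r -> I01 x ->
  Gneum t r x <= kernel_const T / Num.sqrt t.
Proof. by move=> t0 tT Ir Ix; rewrite -lee_fin EFin_Gneum// le_eGneum. Qed.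

Lemma integral_Gneum t r : 0 < t -> I01 r ->
  (\int[mu]_(x in I01) (Gneum t r x)%:E = 1)%E.
Proof.
move=> t0 Ir; rewrite -(integral_eGneum r t0).
by apply: eq_integral => x /[!inE] Ix; rewrite EFin_Gneum.
Qed.

Lemma Gneum_semigroup s t r x : 0 < s -> 0 < t -> I01 r -> I01 x ->
  (\int[mu]_(y in I01) (Gneum s r y * Gneum t y x)%:E = (Gneum (s + t) r x)%:E)%E.
Proof.
move=> s0 t0 Ir Ix; rewrite EFin_Gneum ?addr_gt0// -eGneum_semigroup//.
by apply: eq_integral => y /[!inE] Iy; rewrite EFinM !EFin_Gneum.
Qed.

(* The semigroup property exhibits [Gneum t] as an average of [Gneum e] over the first variable. *)
Lemma Gneum_le_avg e t r r' c : 0 < e -> e <= t -> 0 <= c -> I01 r -> I01 r' ->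
  (forall y, I01 y -> Gneum e r y <= Gneum e r' y + c) ->
  forall x, I01 x -> Gneum t r x <= Gneum t r' x + c.
Proof.
move=> e0; rewrite le_eqVlt => /predU1P[<-//|et] c0 Ir Ir' H x Ix.
have te0 : 0 < t - e by rewrite subr_gt0.
rewrite -lee_fin EFinD -(subrK e t) [(t - e + e)%R]addrC.
rewrite -!Gneum_semigroup// -[c%:E]mule1 -(integral_Gneum te0 Ix).
have mG (f g : R -> R) : measurable_fun I01 f -> measurable_fun I01 g ->
    measurable_fun I01 (fun y => (f y * g y)%:E).
  by move=> *; apply/measurable_EFinP; exact: measurable_funM.
have m1 s z : measurable_fun I01 (Gneum s z) by exact: measurable_Gneum.
have m2 s z : measurable_fun I01 (Gneum s ^~ z) by exact: measurable_Gneum.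
rewrite -ge0_integralZl//; last 2 first.
- by apply/measurable_EFinP; exact: m1.
- by move=> y _; rewrite lee_fin Gneum_ge0.
rewrite -ge0_integralD//; last 4 first.
- by move=> y _; rewrite lee_fin mulr_ge0 ?Gneum_ge0.
- exact: mG.
- by move=> y _; rewrite -EFinM lee_fin mulr_ge0 ?Gneum_ge0.
- by apply: emeasurable_funM => //; apply/measurable_EFinP; exact: m1.
apply: ge0_le_integral => //.
- by move=> y _; rewrite lee_fin mulr_ge0 ?Gneum_ge0.
- exact: mG.
- apply: emeasurable_funD; first exact: mG.
  by apply: emeasurable_funM => //; apply/measurable_EFinP; exact: m1.
- move=> y Iy; rewrite -EFinM -EFinD lee_fin (GneumC _ x) -mulrDl.
  by rewrite ler_wpM2r ?Gneum_ge0 ?H.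
Qed.

Lemma Gneum_le_after e t r x : 0 < e -> e <= t -> I01 r -> I01 x ->
  Gneum t r x <= kernel_const e / Num.sqrt e.
Proof.
move=> e0; rewrite le_eqVlt => /predU1P[<-|et] Ir Ix; first exact: Gneum_le.
have te0 : 0 < t - e by rewrite subr_gt0.
have H y : I01 y -> Gneum e r y <= kernel_const e / Num.sqrt e by exact: Gneum_le.
have : 0 <= kernel_const e / Num.sqrt e.
  by rewrite divr_ge0 ?sqrtr_ge0// ltW// kernel_const_gt0.
move: (kernel_const e / _) H => B H B0.
rewrite -lee_fin -(subrK e t) [(t - e + e)%R]addrC -Gneum_semigroup//.
rewrite -[leRHS]mule1.
rewrite -[X in (_ <= _ * X)%E](integral_Gneum te0 Ix).
rewrite -ge0_integralZl; last 4 first.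
- exact: measurable_itv.
- by apply/measurable_EFinP; exact: measurable_Gneum.
- by move=> y _; rewrite lee_fin Gneum_ge0.
- by rewrite lee_fin.
apply: ge0_le_integral.
- exact: measurable_itv.
- by move=> y _; rewrite lee_fin mulr_ge0 ?Gneum_ge0.
- by apply/measurable_EFinP; apply: measurable_funM; exact: measurable_Gneum.
- by apply: emeasurable_funM => //; apply/measurable_EFinP; exact: measurable_Gneum.
- move=> y Iy; rewrite -EFinM lee_fin (GneumC _ x) ler_wpM2r ?Gneum_ge0//.
  exact: H.
Qed.

Lemma Gneum_lipschitz_at t r r' x : 0 < t -> I01 r -> I01 r' -> I01 x ->
  Gneum t r x <= Gneum t r' x +
  (2 * Num.sqrt (2 * t) + Num.sqrt 2) / (2 * t) * `|r - r'| *
    (Gneum (2 * t) r x + Gneum (2 * t) r' x).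
Proof.
move=> t0 Ir Ir' Ix.
have t20 : 0 < 2 * t by exact: mulr_gt0.
have rr1 : `|r - r'| <= 1.
  by move: Ir Ir'; rewrite /= !in_itv/= ler_norml; lra.
set K := (_ / _ : R).
have K0 : 0 <= K by rewrite divr_ge0 ?addr_ge0 ?mulr_ge0 ?sqrtr_ge0// ltW.
have ip s z n : (0 <= (image_pair s (zenum n) z x)%:E)%E.
  by rewrite lee_fin image_pair_ge0.
rewrite -lee_fin !EFinD EFinM EFinD !EFin_Gneum// !eGneumE -nneseriesD//.
rewrite -nneseriesZl; last by move=> n _; rewrite adde_ge0.
rewrite -nneseriesD//; last by move=> n _ _; rewrite mule_ge0 ?adde_ge0// lee_fin mulr_ge0.
apply: lee_nneseries => // n _.
suff : image_pair t (zenum n) r x <= image_pair t (zenum n) r' x + K * `|r - r'| *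
    (image_pair (2 * t) (zenum n) r x + image_pair (2 * t) (zenum n) r' x) by [].
rewrite /image_pair.
have h1 := Gk_lipschitz (x + 2 * (zenum n)%:~R) t0 rr1.
have h2 := Gk_lipschitz (2 * (zenum n)%:~R - x) t0 rr1.
rewrite -/K in h1 h2.
have := ler_norm (Gk t r (x + 2 * (zenum n)%:~R) - Gk t r' (x + 2 * (zenum n)%:~R)).
have := ler_norm (Gk t r (2 * (zenum n)%:~R - x) - Gk t r' (2 * (zenum n)%:~R - x)).
move: h1 h2; rewrite !mulrDr; lra.
Qed.

Lemma Gneum_lipschitz_after e : 0 < e -> exists2 L, 0 <= L &
  forall t r r' x, e <= t -> I01 r -> I01 r' -> I01 x ->
  Gneum t r x <= Gneum t r' x + L * `|r - r'|.
Proof.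
move=> e0; have e20 : 0 < 2 * e by exact: mulr_gt0.
set K := (2 * Num.sqrt (2 * e) + Num.sqrt 2) / (2 * e).
have K0 : 0 <= K by rewrite divr_ge0 ?addr_ge0 ?mulr_ge0 ?sqrtr_ge0// ltW.
set B := kernel_const (2 * e) / Num.sqrt (2 * e).
have B0 : 0 <= B by rewrite divr_ge0 ?sqrtr_ge0// ltW// kernel_const_gt0.
exists (K * (B + B)); first by rewrite mulr_ge0 ?addr_ge0.
move=> t r r' x et Ir Ir'; move: x; apply: (Gneum_le_avg e0 et _ Ir Ir') => [|y Iy].
  by apply: mulr_ge0 => //; apply: mulr_ge0 => //; exact: addr_ge0.
apply: le_trans (Gneum_lipschitz_at e0 Ir Ir' Iy) _.
by rewrite lerD2l -/K mulrAC ler_wpM2r// ler_wpM2l// lerD// Gneum_le.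
Qed.

Lemma dist_Gneum_le t r x : 0 < t -> I01 r -> I01 x ->
  `|r - x| * Gneum t r x <= Num.sqrt (2 * t) * Gneum (2 * t) r x.
Proof.
move=> t0 Ir Ix; have t20 : 0 < 2 * t by exact: mulr_gt0.
rewrite -lee_fin !EFinM !EFin_Gneum// !eGneumE -!nneseriesZl;
  try by move=> n _; rewrite lee_fin image_pair_ge0.
apply: lee_nneseries => [n _ _|n _].
  by rewrite -EFinM lee_fin mulr_ge0 ?image_pair_ge0.
rewrite -!EFinM lee_fin /image_pair !mulrDr.
have H z : `|r - x| <= `|r - z| -> `|r - x| * Gk t r z <= Num.sqrt (2 * t) * Gk (2 * t) r z.
  by move=> h; apply: le_trans (dist_Gk_le r z t0); rewrite ler_wpM2r ?Gk_ge0.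
move: Ir Ix; rewrite /= !in_itv/= => /andP[r0 r1] /andP[x0 x1].
have Z (k : int) : [\/ k%:~R = 0 :> R, k%:~R <= -1 :> R | 1 <= k%:~R :> R].
  case: k => [[|k]|k]; [by constructor 1|constructor 3|constructor 2].
    by rewrite -[1]/(1%:~R) ler_int.
  by rewrite -[-1]/((-1)%:~R) ler_int.
have [r_x|x_r] := leP r x.
- rewrite lerD//; apply: H; rewrite [`|r - x|]ler0_norm ?subr_le0// ler_normr;
    apply/orP; case: (Z (zenum n)) => ?; solve [left; lra | right; lra].
- rewrite lerD//; apply: H; rewrite [`|r - x|]gtr0_norm ?subr_gt0// ler_normr;
    apply/orP; case: (Z (zenum n)) => ?; solve [left; lra | right; lra].
Qed.

End neumann_kernel_estimates.

(** * Measures on the unit interval and the heat flow *)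

Section unit_interval_integrals.
Context {R : realType}.
Local Notation mu := (@lebesgue_measure R).
Local Notation I01 := (`[0, 1]%classic : set R).
Local Open Scope ereal_scope.

Lemma measurable_integral01 (f : R * R -> \bar R) : measurable_fun setT f ->
  (forall z, 0 <= f z) -> measurable_fun setT (fun x => \int[mu]_(y in I01) f (x, y)).
Proof.
move=> mf f0.
have mI : measurable (setT `*` I01 : set (R * R)) by exact: measurableX.
have mg : measurable_fun setT (f \_ (setT `*` I01)).
  by apply/(measurable_restrictT _ mI); exact: measurable_funS mf.
have g0 z : 0 <= (f \_ (setT `*` I01)) z by rewrite erestrict_ge0.
have := measurable_fun_fubini_tonelli_F (m2 := mu) _ mg g0.
rewrite /fubini_F; congr measurable_fun; apply/funext => x.
rewrite [RHS]integral_mkcond; apply: eq_integral => y _.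
rewrite !patchE; congr (if _ then _ else _).
by apply/idP/idP; rewrite !inE => // -[].
Qed.

Lemma fubini_tonelli01 (f : R * R -> \bar R) : measurable_fun setT f ->
  (forall z, 0 <= f z) ->
  \int[mu]_(x in I01) \int[mu]_(y in I01) f (x, y) =
  \int[mu]_(y in I01) \int[mu]_(x in I01) f (x, y).
Proof.
move=> mf f0.
have mI : measurable (I01 `*` I01 : set (R * R)) by exact: measurableX.
have mg : measurable_fun setT (f \_ (I01 `*` I01)).
  by apply/(measurable_restrictT _ mI); exact: measurable_funS mf.
have g0 z : 0 <= (f \_ (I01 `*` I01)) z by rewrite erestrict_ge0.
have := fubini_tonelli (m1 := mu) (m2 := mu) _ mg g0.
have inI x y : ((x, y) \in I01 `*` I01) = (x \in I01) && (y \in I01).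
  by apply/idP/andP; rewrite !inE.
have H (h : R * R -> \bar R) : \int[mu]_x \int[mu]_y (h \_ (I01 `*` I01)) (x, y) =
    \int[mu]_(x in I01) \int[mu]_(y in I01) h (x, y).
  rewrite [RHS]integral_mkcond; apply: eq_integral => x _; rewrite patchE.
  have [xI|xI] := boolP (x \in I01).
    rewrite [RHS]integral_mkcond; apply: eq_integral => y _.
    by rewrite !patchE inI xI.
  by apply: integral0_eq => y _; rewrite patchE inI (negbTE xI).
rewrite H => ->; pose h z := f (z.2, z.1); rewrite -(H h).
apply: eq_integral => y _; apply: eq_integral => x _.
by rewrite !patchE !inI andbC.
Qed.

End unit_interval_integrals.

Section positive_measures.
Context {R : realType}.
Implicit Types (m : meas R) (M t r : R).
Local Notation mu := (@lebesgue_measure R).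
Local Notation I01 := (`[0, 1]%classic : set R).

Definition posmeas M m := [/\ 0 <= atom m, measurable_fun I01 (dens m),
  forall x, I01 x -> 0 <= dens m x &
  ((atom m)%:E + \int[mu]_(x in I01) (dens m x)%:E = M%:E)%E].

Lemma integral_dens M m : posmeas M m ->
  (\int[mu]_(x in I01) (dens m x)%:E = (M - atom m)%:E)%E.
Proof.
by case=> _ _ _ E; rewrite EFinB -E addeAC subee// add0e.
Qed.

Definition pairing m (f : R -> R) : \bar R :=
  ((atom m * f 0)%:E + \int[mu]_(x in I01) (f x * dens m x)%:E)%E.

Lemma pairing_le M m (f g : R -> R) c : posmeas M m ->
  measurable_fun I01 f -> measurable_fun I01 g ->
  (forall x, I01 x -> 0 <= f x) -> (forall x, I01 x -> 0 <= g x) -> 0 <= c ->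
  (forall x, I01 x -> f x <= g x + c) ->
  (pairing m f <= pairing m g + (c * M)%:E)%E.
Proof.
move=> pm mf mg f0 g0 c0 fg; have [a0 md d0 E] := pm.
have I0 : I01 0 by rewrite /= in_itv/= lexx ler01.
have mp (h : R -> R) : measurable_fun I01 h -> measurable_fun I01 (fun x => (h x * dens m x)%:E).
  by move=> mh; apply/measurable_EFinP; exact: measurable_funM.
rewrite EFinM -E ge0_muleDr ?lee_fin//; last first.
  by apply: integral_ge0 => x Ix; rewrite lee_fin d0.
rewrite -ge0_integralZl ?lee_fin//; last exact/measurable_EFinP.
rewrite /pairing addeACA leeD//.
  by rewrite -EFinM -EFinD lee_fin [c * _]mulrC -mulrDr ler_wpM2l// fg.
rewrite -ge0_integralD//; last 4 first.
- by move=> x Ix; rewrite lee_fin mulr_ge0 ?g0 ?d0.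
- exact: mp.
- by move=> x Ix; rewrite -EFinM lee_fin mulr_ge0 ?d0.
- by apply/measurable_EFinP; exact: measurable_funM.
apply: ge0_le_integral => //.
- by move=> x Ix; rewrite lee_fin mulr_ge0 ?f0 ?d0.
- exact: mp.
- apply: emeasurable_funD; first exact: mp.
  by apply/measurable_EFinP; exact: measurable_funM.
- by move=> x Ix; rewrite -EFinM -EFinD lee_fin -mulrDl ler_wpM2r ?d0 ?fg.
Qed.

Lemma pairing0 m : pairing m (fun=> 0) = 0%E.
Proof.
rewrite /pairing mulr0 add0e integral0_eq// => x _; by rewrite mul0r.
Qed.

Lemma pairing_ub M m (f : R -> R) c : posmeas M m -> measurable_fun I01 f ->
  (forall x, I01 x -> 0 <= f x) -> 0 <= c -> (forall x, I01 x -> f x <= c) ->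
  (pairing m f <= (c * M)%:E)%E.
Proof.
move=> pm mf f0 c0 fc; rewrite -[leRHS]add0e -(pairing0 m).
by apply: pairing_le => // x Ix; rewrite add0r fc.
Qed.

Lemma EFin_heat M t m r : 0 < t -> posmeas M m -> I01 r ->
  (dens (heat t m) r)%:E = pairing m (Gneum t r).
Proof.
move=> t0 pm Ir; have Ir' := Ir; have [a0 md d0 _] := pm.
have mG : measurable_fun I01 (Gneum t r) by exact: measurable_Gneum.
have := pairing_ub pm mG (fun x _ => Gneum_ge0 t r x) _ (fun x Ix => Gneum_le t0 (lexx t) Ir Ix).
rewrite divr_ge0 ?sqrtr_ge0 ?(ltW (kernel_const_gt0 _))// => /(_ isT) ub.
move: Ir; rewrite /= in_itv/= => -> /=.
rewrite EFinD fineK ?EFinM// ge0_fin_numE.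
  apply: le_lt_trans (ltry _); apply: le_trans ub.
  rewrite /pairing leeDr// lee_fin mulr_ge0// Gneum_ge0//.
by apply: integral_ge0 => x Ix; rewrite lee_fin mulr_ge0 ?Gneum_ge0 ?d0.
Qed.

Lemma heat_ge0 M t m r : 0 < t -> posmeas M m -> 0 <= dens (heat t m) r.
Proof.
move=> t0 pm; rewrite /=; case: ifPn => // rI.
have [a0 md d0 _] := pm.
rewrite addr_ge0 ?mulr_ge0 ?Gneum_ge0// fine_ge0//.
by apply: integral_ge0 => x Ix; rewrite lee_fin mulr_ge0 ?Gneum_ge0 ?d0.
Qed.

Lemma measurable_kernel_dens t m (psi : R -> R) : measurable_fun I01 (dens m) ->
  measurable_fun setT psi ->
  measurable_fun setT (fun z : R * R => (psi z.1 * Gneum t z.1 z.2 * (dens m \_ I01) z.2)%:E).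
Proof.
move=> md mpsi; apply/measurable_EFinP.
apply: measurable_funM; last first.
  by apply: measurableT_comp => //; apply/(measurable_restrictT _ (measurable_itv _)).
apply: measurable_funM; first exact: measurableT_comp.
exact: measurable_Gneum.
Qed.

Lemma restrict_dens_ge0 M m : posmeas M m -> forall x, 0 <= (dens m \_ I01) x.
Proof.
by case=> _ _ d0 _ x; rewrite patchE; case: ifPn => // /[!inE]; exact: d0.
Qed.

Lemma measurable_heat M t m : 0 < t -> posmeas M m ->
  measurable_fun I01 (dens (heat t m)).
Proof.
move=> t0 pm; have [a0 md d0 _] := pm.
apply/measurable_EFinP.
apply: (eq_measurable_fun (fun r => (atom m * Gneum t r 0)%:E +
  \int[mu]_(x in I01) (1 * Gneum t r x * (dens m \_ I01) x)%:E)%E).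
  move=> r /[!inE] Ir; rewrite /= (EFin_heat t0 pm Ir)//; congr (_ + _)%E.
  by apply: eq_integral => x Ix; rewrite patchE Ix mul1r.
apply: emeasurable_funD.
  apply/measurable_EFinP; apply: measurable_funM => //; exact: measurable_Gneum.
have mF := measurable_kernel_dens t md (measurable_cst (1 : R)).
apply: (@measurable_funS _ _ _ _ setT) => //.
apply: (measurable_integral01 mF) => z.
by rewrite lee_fin !mulr_ge0 ?Gneum_ge0 ?(restrict_dens_ge0 pm).
Qed.

Lemma integral_heat M t m (psi : R -> R) : 0 < t -> posmeas M m ->
  measurable_fun setT psi -> (forall x, 0 <= psi x) ->
  (\int[mu]_(y in I01) (psi y * dens (heat t m) y)%:E =
   (atom m)%:E * \int[mu]_(y in I01) (psi y * Gneum t y 0)%:E +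
   \int[mu]_(x in I01) ((\int[mu]_(y in I01) (psi y * Gneum t y x)%:E) * (dens m x)%:E))%E.
Proof.
move=> t0 pm mpsi psi0; have [a0 md d0 _] := pm.
have mG x : measurable_fun I01 (fun y => (psi y * Gneum t y x)%:E).
  apply/measurable_EFinP; apply: measurable_funM; last exact: measurable_Gneum.
  exact: measurable_funS mpsi.
have G0 x y : (0 <= (psi y * Gneum t y x)%:E)%E by rewrite lee_fin mulr_ge0 ?Gneum_ge0.
pose F (z : R * R) : \bar R := (psi z.1 * Gneum t z.1 z.2 * (dens m \_ I01) z.2)%:E.
have mF : measurable_fun setT F by exact: measurable_kernel_dens.
have F0 z : (0 <= F z)%E.
  by rewrite lee_fin !mulr_ge0 ?Gneum_ge0 ?(restrict_dens_ge0 pm).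
transitivity (\int[mu]_(y in I01) ((atom m)%:E * (psi y * Gneum t y 0)%:E +
    \int[mu]_(x in I01) F (y, x)))%E.
  apply: eq_integral => y /[!inE] Iy.
  rewrite EFinM (EFin_heat t0 pm Iy) ge0_muleDr ?lee_fin ?mulr_ge0 ?Gneum_ge0//; last first.
    by apply: integral_ge0 => x Ix; rewrite lee_fin mulr_ge0 ?Gneum_ge0 ?d0.
  congr (_ + _)%E; first by rewrite -!EFinM mulrCA.
  rewrite -ge0_integralZl//.
  - by apply: eq_integral => x Ix; rewrite /F/= patchE Ix -EFinM mulrA.
  - by apply/measurable_EFinP; apply: measurable_funM => //; exact: measurable_Gneum.
  - by move=> x Ix; rewrite lee_fin mulr_ge0 ?Gneum_ge0 ?d0.
  - by rewrite lee_fin.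
rewrite ge0_integralD//; last 4 first.
- by move=> y _; rewrite mule_ge0 ?G0 ?lee_fin.
- by apply: measurable_funeM; exact: mG.
- by move=> y _; apply: integral_ge0.
- by apply: (@measurable_funS _ _ _ _ setT) => //; exact: measurable_integral01.
rewrite ge0_integralZl ?lee_fin//; last exact: mG.
congr (_ + _)%E.
rewrite (fubini_tonelli01 mF F0); apply: eq_integral => x /[!inE] Ix.
rewrite muleC -ge0_integralZl ?lee_fin ?d0//; last exact: mG.
by apply: eq_integral => y _; rewrite /F/= patchE mem_set// -EFinM mulrC.
Qed.

Lemma posmeas_heat M t m : 0 < t -> posmeas M m -> posmeas M (heat t m).
Proof.
move=> t0 pm; split => //.
- exact: measurable_heat pm.
- by move=> x _; exact: heat_ge0 pm.
- rewrite add0e.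
  have := integral_heat t0 pm (measurable_cst (1 : R)) (fun _ => ler01).
  under eq_integral do rewrite mul1r; move=> ->.
  have H x : I01 x -> (\int[mu]_(y in I01) (1 * Gneum t y x)%:E = 1)%E.
    move=> Ix; rewrite -(integral_Gneum t0 Ix).
    by apply: eq_integral => y _; rewrite mul1r GneumC.
  rewrite /cst H ?mule1; last by rewrite /= in_itv/= lexx ler01.
  have [_ _ _ <-] := pm; congr (_ + _)%E.
  by apply: eq_integral => x /[!inE] Ix; rewrite H// mul1e.
Qed.

Lemma heat_heat M s t m r : 0 < s -> 0 < t -> posmeas M m -> I01 r ->
  dens (heat s (heat t m)) r = dens (heat (s + t) m) r.
Proof.
move=> s0 t0 pm Ir; apply: EFin_inj.
rewrite (EFin_heat s0 (posmeas_heat t0 pm) Ir) (EFin_heat (addr_gt0 s0 t0) pm Ir).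
rewrite /pairing mul0r add0e (integral_heat t0 pm)//; last first.
- by move=> x; exact: Gneum_ge0.
- exact: measurable_Gneum.
have I0 : I01 0 by rewrite /= in_itv/= lexx ler01.
rewrite Gneum_semigroup// -EFinM; congr (_ + _)%E.
by apply: eq_integral => x /[!inE] Ix; rewrite Gneum_semigroup.
Qed.

End positive_measures.

Section heat_estimates.
Context {R : realType}.
Implicit Types (m : meas R) (M t r : R).
Local Notation mu := (@lebesgue_measure R).
Local Notation I01 := (`[0, 1]%classic : set R).

Lemma posmeas_mass_ge0 M m : posmeas M m -> 0 <= M.
Proof.
case=> a0 _ d0 E; rewrite -lee_fin -E adde_ge0// ?lee_fin//.
by apply: integral_ge0 => x Ix; rewrite lee_fin d0.
Qed.

Lemma heat_ub M t m r c : 0 < t -> posmeas M m -> I01 r -> 0 <= c ->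
  (forall x, I01 x -> Gneum t r x <= c) -> dens (heat t m) r <= c * M.
Proof.
move=> t0 pm Ir c0 Gc; suff : (pairing m (Gneum t r) <= (c * M)%:E)%E by rewrite -(EFin_heat t0 pm Ir) lee_fin.
apply: pairing_ub => //; first exact: measurable_Gneum.
by move=> x _; exact: Gneum_ge0.
Qed.

Lemma heat_lipschitz M e m : 0 < e -> posmeas M m -> exists2 L, 0 <= L &
  forall t r r' m', e <= t -> posmeas M m' -> I01 r -> I01 r' ->
  `|dens (heat t m') r - dens (heat t m') r'| <= L * `|r - r'|.
Proof.
move=> e0 pm; have [L L0 H] := @Gneum_lipschitz_after R e e0.
have M0 := posmeas_mass_ge0 pm.
exists (L * M); first exact: mulr_ge0.
have one t r r' m' : e <= t -> posmeas M m' -> I01 r -> I01 r' ->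
    dens (heat t m') r <= dens (heat t m') r' + L * M * `|r - r'|.
  move=> et pm' Ir Ir'; have t0 : 0 < t by exact: lt_le_trans et.
  suff : (pairing m' (Gneum t r) <=
      pairing m' (Gneum t r') + (L * `|r - r'| * M)%:E)%E.
    rewrite -(EFin_heat t0 pm' Ir) -(EFin_heat t0 pm' Ir') mulrAC.
    by rewrite -EFinD lee_fin.
  apply: pairing_le => //.
  - exact: measurable_Gneum.
  - exact: measurable_Gneum.
  - by move=> x _; exact: Gneum_ge0.
  - by move=> x _; exact: Gneum_ge0.
  - exact: mulr_ge0.
  - by move=> x Ix; exact: H.
move=> t r r' m' et pm' Ir Ir'.
have := one _ _ _ _ et pm' Ir Ir'; have := one _ _ _ _ et pm' Ir' Ir.
move: (dens _ r) (dens _ r') => p q; rewrite (distrC r' r) ler_norml => h1 h2.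
by apply/andP; split; lra.
Qed.

Lemma heat_le_ae M B t m r : 0 < t -> posmeas M m -> atom m = 0 -> I01 r -> 0 <= B ->
  {ae mu, forall x, I01 x -> dens m x <= B} -> dens (heat t m) r <= B.
Proof.
move=> t0 pm am Ir B0 mB; have [_ md d0 _] := pm.
have mG : measurable_fun I01 (Gneum t r) by exact: measurable_Gneum.
suff : (pairing m (Gneum t r) <= B%:E)%E by rewrite -(EFin_heat t0 pm Ir) lee_fin.
rewrite /pairing am mul0r add0e.
rewrite -[leRHS]mule1 -[X in (_ <= _ * X)%E](integral_Gneum t0 Ir).
rewrite -ge0_integralZl; last 4 first.
- exact: measurable_itv.
- exact/measurable_EFinP.
- by move=> y _; rewrite lee_fin Gneum_ge0.
- by rewrite lee_fin.
apply: ae_ge0_le_integral => //.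
- by move=> x Ix; rewrite lee_fin mulr_ge0 ?Gneum_ge0 ?d0.
- by apply/measurable_EFinP; exact: measurable_funM.
- by move=> x Ix; rewrite -EFinM lee_fin mulr_ge0 ?Gneum_ge0.
- by apply/measurable_EFinP; exact: measurable_funM.
- move: mB; apply: (@filterS _ _ (ae_filter_ringOfSetsType mu)) => x H Ix.
  by rewrite -EFinM lee_fin mulrC ler_wpM2r ?Gneum_ge0 ?H.
Qed.

(* The heat flow moves mass over a distance of order [sqrt t]. *)
Lemma heat_near_id M t m r a b : 0 < t -> posmeas M m -> atom m = 0 -> I01 r ->
  0 <= a -> 0 <= b ->
  (forall x, I01 x -> `|dens m x - dens m r| <= a + b * `|r - x|) ->
  `|dens (heat t m) r - dens m r| <= a + b * Num.sqrt (2 * t).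
Proof.
move=> t0 pm am Ir a0 b0 H; have [_ md d0 _] := pm.
have t20 : 0 < 2 * t by exact: mulr_gt0.
have mG s : measurable_fun I01 (Gneum s r) by exact: measurable_Gneum.
have mGe s : measurable_fun I01 (fun x => (Gneum s r x)%:E) by exact/measurable_EFinP.
have avg c s : 0 < s -> 0 <= c ->
    (\int[mu]_(x in I01) (c%:E * (Gneum s r x)%:E) = c%:E)%E.
  move=> s0 c0; rewrite ge0_integralZl.
  - by rewrite integral_Gneum// mule1.
  - exact: measurable_itv.
  - exact: mGe.
  - by move=> x _; rewrite lee_fin Gneum_ge0.
  - by rewrite lee_fin.
have pos c s x : 0 <= c -> (0 <= c%:E * (Gneum s r x)%:E)%E.
  by move=> c0; rewrite -EFinM lee_fin mulr_ge0 ?Gneum_ge0.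
have mc c s : measurable_fun I01 (fun x => c%:E * (Gneum s r x)%:E)%E.
  exact: measurable_funeM.
have bs0 : 0 <= b * Num.sqrt (2 * t) by rewrite mulr_ge0 ?sqrtr_ge0.
have mGd : measurable_fun I01 (fun x => (Gneum t r x * dens m x)%:E).
  by apply/measurable_EFinP; exact: measurable_funM.
have Gd0 x : I01 x -> (0 <= (Gneum t r x * dens m x)%:E)%E.
  by move=> Ix; rewrite lee_fin mulr_ge0 ?Gneum_ge0 ?d0.
have E : (dens (heat t m) r)%:E = (\int[mu]_(x in I01) (Gneum t r x * dens m x)%:E)%E.
  by rewrite (EFin_heat t0 pm Ir) /pairing am mul0r add0e.
have mom x : I01 x -> b * `|r - x| * Gneum t r x <= b * Num.sqrt (2 * t) * Gneum (2 * t) r x.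
  by move=> Ix; rewrite -!mulrA ler_wpM2l// dist_Gneum_le.
move: E; move: (dens (heat t m) r) => h E.
have up : h <= dens m r + (a + b * Num.sqrt (2 * t)).
  rewrite -lee_fin E addrA EFinD -(avg _ _ t0 (addr_ge0 (d0 _ Ir) a0)) -(avg _ _ t20 bs0).
  rewrite -ge0_integralD; last 5 first.
  - exact: measurable_itv.
  - by move=> x _; apply: pos; rewrite addr_ge0 ?d0.
  - exact: mc.
  - by move=> x _; exact: pos.
  - exact: mc.
  apply: ge0_le_integral => //.
  - by apply: emeasurable_funD; exact: mc.
  - move=> x Ix; rewrite -!EFinM -EFinD lee_fin.
    have := H x Ix; rewrite ler_norml => /andP[_ hh].
    have h' : Gneum t r x * dens m x <= Gneum t r x * (dens m r + a + b * `|r - x|).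
      by rewrite ler_wpM2l ?Gneum_ge0//; lra.
    have := mom x Ix; lra.
have dn : dens m r <= h + (a + b * Num.sqrt (2 * t)).
  rewrite -lee_fin -{1}(avg _ _ t0 (d0 _ Ir)) !EFinD E -(avg _ _ t0 a0) -(avg _ _ t20 bs0).
  rewrite -ge0_integralD; last 5 first.
  - exact: measurable_itv.
  - by move=> x _; exact: pos.
  - exact: mc.
  - by move=> x _; exact: pos.
  - exact: mc.
  rewrite -ge0_integralD; last 5 first.
  - exact: measurable_itv.
  - exact: Gd0.
  - exact: mGd.
  - by move=> x _; rewrite adde_ge0// pos.
  - by apply: emeasurable_funD; exact: mc.
  apply: ge0_le_integral => //.
  - by move=> x Ix; apply: pos; exact: d0.
  - exact: mc.
  - apply: emeasurable_funD; first exact: mGd.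
    by apply: emeasurable_funD; exact: mc.
  - move=> x Ix; rewrite -!EFinM -!EFinD lee_fin.
    have := H x Ix; rewrite ler_norml => /andP[hh _].
    have h' : Gneum t r x * dens m r <= Gneum t r x * (dens m x + a + b * `|r - x|).
      by rewrite ler_wpM2l ?Gneum_ge0//; lra.
    have := mom x Ix; lra.
by rewrite ler_norml; apply/andP; split; lra.
Qed.

End heat_estimates.

(** * The cut operator *)

Section cut_operator.
Context {R : realType}.
Implicit Types (m : meas R) (M t r c : R).
Local Notation mu := (@lebesgue_measure R).
Local Notation I01 := (`[0, 1]%classic : set R).

Lemma integral01_split (f : R -> \bar R) c : I01 c -> measurable_fun I01 f ->
  (forall x, I01 x -> 0 <= f x)%E ->
  (\int[mu]_(x in I01) f x =
   \int[mu]_(x in `[0%R, c]) f x + \int[mu]_(x in `[c, 1%R]) f x)%E.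
Proof.
rewrite /= in_itv/= => /andP[c0 c1] mf f0.
have Es : I01 = (`[0, c] `|` `]c, 1])%classic.
  by rewrite -itv_bndbnd_setU ?bnd_simp.
have s1 : `]c, 1]%classic `<=` I01.
  by move=> x; rewrite /= !in_itv/=; lra.
rewrite -[X in (_ = _ + X)%E]integral_itv_obnd_cbnd; last exact: measurable_funS mf.
rewrite {1}Es ge0_integral_setU//; rewrite -?Es//.
by rewrite disj_set2E; apply/eqP/seteqP; split=> // x [] /=; rewrite !in_itv/=; lra.
Qed.

Lemma integral01_cut (f : R -> R) c : I01 c -> measurable_fun I01 f ->
  (forall x, I01 x -> 0 <= f x) ->
  (\int[mu]_(x in I01) (if x <= c then f x else 0)%:E =
   \int[mu]_(x in `[0%R, c]) (f x)%:E)%E.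
Proof.
rewrite /= in_itv/= => /andP[c0 c1] mf f0.
have s1 : `[0, c]%classic `<=` I01.
  by move=> x; rewrite /= !in_itv/=; lra.
rewrite [LHS]integral_mkcond [RHS]integral_mkcond; apply: eq_integral => x _.
rewrite !patchE; case: (boolP (x \in I01)); case: (boolP (x \in `[0, c]%classic)) => //.
- by rewrite !inE/= !in_itv/= => /andP[_ ->].
- rewrite notin_setE inE/= !in_itv/= => xc /andP[x0 _].
  by case: ifPn => // xc'; exfalso; apply: xc; rewrite x0.
- by rewrite inE notin_setE => /s1.
Qed.

Lemma Rdel_spec M j delta m : posmeas M m -> atom m = 0 ->
  0 < j * delta -> j * delta < M ->
  let c := Rdel j delta m in
  I01 c /\ (\int[mu]_(x in `[0%R, c]) (dens m x)%:E = (M - j * delta)%:E)%E.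
Proof.
move=> pm am a0 aM; have [_ md d0 _] := pm.
set a := j * delta in a0 aM *.
have IM : (\int[mu]_(x in I01) (dens m x)%:E = M%:E)%E.
  by rewrite (integral_dens pm) am subr0.
pose H x := parameterized_integral mu 0 x (dens m).
have sub x : I01 x -> `[0, x]%classic `<=` I01.
  by rewrite /= in_itv/= => /andP[_ x1] y; rewrite /= !in_itv/=; lra.
have H0 x : I01 x -> (0 <= \int[mu]_(y in `[0%R, x]) (dens m y)%:E)%E.
  by move=> Ix; apply: integral_ge0 => y /(sub _ Ix) Iy; rewrite lee_fin d0.
have HE x : I01 x -> (\int[mu]_(y in `[0%R, x]) (dens m y)%:E = (H x)%:E)%E.
  move=> Ix; rewrite /H /parameterized_integral /Rintegral fineK// ge0_fin_numE ?H0//.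
  rewrite (@le_lt_trans _ _ M%:E) ?ltry// -IM; apply: ge0_subset_integral => //.
  - exact/measurable_EFinP.
  - exact: sub.
have mono x y : I01 x -> I01 y -> x <= y -> H x <= H y.
  move=> Ix Iy xy; rewrite -lee_fin -!HE//; apply: ge0_subset_integral => //.
  - by apply/measurable_EFinP; exact: measurable_funS (sub _ Iy) md.
  - by move=> z /(sub _ Iy) Iz; rewrite lee_fin d0.
  - by move=> z; rewrite /= !in_itv/= => /andP[-> /le_trans->].
have I0 : I01 0 by rewrite /= in_itv/= lexx ler01.
have I1 : I01 1 by rewrite /= in_itv/= lexx ler01.
have H1 : H 1 = M by apply: EFin_inj; rewrite -HE.
have H00 : H 0 = 0 by apply: EFin_inj; rewrite -HE// set_itv1 integral_set1.
have cH : {within I01, continuous H}.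
  apply: parameterized_integral_continuous => //.
  apply/integrableP; split; first exact/measurable_EFinP.
  apply: (@le_lt_trans _ _ M%:E); last exact: ltry.
  rewrite -IM le_eqVlt; apply/orP; left; apply/eqP; apply: eq_integral => x /[!inE] Ix.
  by rewrite /= ger0_norm ?d0.
have FE r : I01 r -> Fm r m = (M - H r)%:E.
  move=> Ir; rewrite /Fm am if_same add0e.
  have -> : `[r, 1] `&` `[0, 1] = `[r, 1]%classic.
    apply/seteqP; split=> [x []//|x xr]; split=> //.
    by move: xr Ir; rewrite /= !in_itv/=; lra.
  have mde : measurable_fun I01 (fun x => (dens m x)%:E) by exact/measurable_EFinP.
  have de0 x : I01 x -> (0 <= (dens m x)%:E)%E by move=> Ix; rewrite lee_fin d0.
  have := integral01_split Ir mde de0; rewrite IM HE// EFinB => ->.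
  by rewrite addeAC subee// add0e.
pose S := [set r : R | Fm r m = a%:E].
have SE r : S r <-> I01 r /\ H r = M - a.
  split=> [|[Ir Hr]]; last by rewrite /S/= FE// Hr; congr (_%:E); ring.
  rewrite /S/= => Fr.
  have Ir : I01 r.
    rewrite /= in_itv/=; have [r0|r0] := ltP r 0.
      exfalso; move: Fr; rewrite /Fm am if_same add0e.
      have -> : `[r, 1] `&` `[0, 1] = I01.
        apply/seteqP; split=> [x []//|x xr]; split=> //.
        by move: xr; rewrite /= !in_itv/=; lra.
      by rewrite IM => -[Ma]; move: aM; rewrite Ma ltxx.
    have [r1|//] := ltP 1 r; exfalso; move: Fr; rewrite /Fm am if_same add0e.
    rewrite [X in X `&` _]set_itv_ge ?bnd_simp -?ltNge// set0I integral_set0 => -[].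
    by move=> a00; move: a0; rewrite -a00 ltxx.
  by split=> //; move: Fr; rewrite FE// => -[<-]; ring.
have itvI x y : I01 x -> I01 y -> `[x, y]%classic `<=` I01.
  by rewrite /= !in_itv/= => Ix Iy z; rewrite /= !in_itv/=; lra.
have ivt x y v : I01 x -> I01 y -> x <= y -> H x <= v -> v <= H y ->
    exists2 d, I01 d /\ x <= d <= y & H d = v.
  move=> Ix Iy xy xv vy.
  have [d dxy Hd] : exists2 d, d \in `[x, y] & H d = v.
    apply: IVT => //; first exact: continuous_subspaceW (itvI _ _ Ix Iy) cH.
    by rewrite ge_min xv/= le_max vy orbT.
  by exists d => //; split; [exact: itvI dxy|move: dxy; rewrite in_itv].
have [r0 [Ir0 _] Hr0] : exists2 d, I01 d /\ 0 <= d <= 1 & H d = M - a.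
  by apply: ivt => //; rewrite ?H00 ?H1; lra.
have Sr0 : S r0 by exact/SE.
have Slb : lbound S 0 by move=> r /SE[]; rewrite /= in_itv/= => /andP[].
have hS : has_inf S by split; [exists r0|exists 0].
rewrite /= /Rdel -/a -/S; set c := inf S.
have c0 : 0 <= c by apply: lb_le_inf => //; exists r0.
have cr0 : c <= r0 by apply: ge_inf => //; exact: hS.2.
have Ic : I01 c by move: Ir0; rewrite /= !in_itv/=; lra.
split=> //; rewrite HE//; congr (_%:E).
have Hc : H c <= M - a by rewrite -Hr0; exact: mono.
apply/eqP; rewrite eq_le Hc/= leNgt; apply/negP => Hc'.
have [d [Id /andP[cd _]] Hd] : exists2 d, I01 d /\ c <= d <= r0 &
    H d = (H c + (M - a)) / 2.
  by apply: ivt => //; rewrite ?Hr0; lra.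
have cd' : c < d.
  by rewrite lt_neqAle cd andbT; apply/eqP => E; move: Hd; rewrite -E; lra.
suff : d <= c by rewrite leNgt cd'.
apply: lb_le_inf; first by exists r0.
move=> s /SE[Is Hs]; rewrite leNgt; apply/negP => /ltW sd.
by have := mono _ _ Is Id sd; rewrite Hs Hd; lra.
Qed.

End cut_operator.

Section cut_operator_theory.
Context {R : realType}.
Local Notation mu := (@lebesgue_measure R).
Local Notation I01 := (`[0, 1]%classic : set R).

Definition cut_tail j delta (m : meas R) : meas R :=
  Meas 0 (fun x => dens m x - dens (Kop j delta m) x).

Section one_measure.
Variables (M j delta : R) (m : meas R).
Hypotheses (pm : posmeas M m) (am : atom m = 0).
Hypotheses (a0 : 0 < j * delta) (aM : j * delta < M).
Local Notation a := (j * delta).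
Local Notation K := (Kop j delta m).

Lemma dens_Kop x : I01 x -> dens K x = if x <= Rdel j delta m then dens m x else 0.
Proof. by rewrite /= in_itv/= => /andP[-> _]. Qed.

Lemma dens_Kop_ge0 x : I01 x -> 0 <= dens K x.
Proof.
by case: pm => _ _ d0 _ Ix; rewrite dens_Kop//; case: ifP => // _; exact: d0.
Qed.

Lemma dens_Kop_le x : I01 x -> dens K x <= dens m x.
Proof.
by case: pm => _ _ d0 _ Ix; rewrite dens_Kop//; case: ifP => // _; exact: d0.
Qed.

Lemma measurable_dens_Kop : measurable_fun I01 (dens K).
Proof.
case: pm => _ md _ _.
apply: (@eq_measurable_fun _ _ R R I01 (fun x : R => (if x <= Rdel j delta m then dens m x else 0) : R)).
  by move=> x /[!inE] Ix; rewrite dens_Kop.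
apply: measurable_fun_if => //; first by apply: measurable_fun_ler.
by apply: measurable_funS md => // x [].
Qed.

Lemma integral_dens_Kop : (\int[mu]_(x in I01) (dens K x)%:E = (M - a)%:E)%E.
Proof.
have [_ md d0 _] := pm; have [Ic <-] := Rdel_spec pm am a0 aM.
rewrite -(integral01_cut Ic md d0).
by apply: eq_integral => x /[!inE] Ix; rewrite dens_Kop.
Qed.

Lemma posmeas_Kop : posmeas M K.
Proof.
split; last first.
- by rewrite integral_dens_Kop /= am addr0 -EFinD; congr (_%:E); ring.
- exact: dens_Kop_ge0.
- exact: measurable_dens_Kop.
- by rewrite /= am addr0 ltW.
Qed.

Lemma posmeas_cut_tail : posmeas a (cut_tail j delta m).
Proof.
have [_ md d0 _] := pm; have mK := measurable_dens_Kop.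
have mt : measurable_fun I01 (fun x => dens m x - dens K x) by exact: measurable_funB.
have t0 x : I01 x -> 0 <= dens m x - dens K x.
  by move=> Ix; rewrite subr_ge0 dens_Kop_le.
split => //.
have : (\int[mu]_(x in I01) ((dens K x)%:E + (dens m x - dens K x)%:E) = M%:E)%E.
  have -> : M%:E = (\int[mu]_(x in I01) (dens m x)%:E)%E.
    by rewrite (integral_dens pm) am subr0.
  by apply: eq_integral => x _; rewrite -EFinD addrC subrK.
rewrite ge0_integralD//; last 3 first.
- by move=> x Ix; rewrite lee_fin dens_Kop_ge0.
- exact/measurable_EFinP.
- exact/measurable_EFinP.
rewrite integral_dens_Kop add0e /=.
case: (integral _ _ _) => // s; rewrite -EFinD => -[E]; congr (_%:E); lra.
Qed.

Lemma pairing_Kop (f : R -> R) : measurable_fun I01 f ->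
  (forall x, I01 x -> 0 <= f x) ->
  (pairing K f + pairing (cut_tail j delta m) f = pairing m f + (a * f 0)%:E)%E.
Proof.
move=> mf f0; have [_ md d0 _] := pm.
have [_ mt t0 _] := posmeas_cut_tail.
have aK : atom K = a by rewrite /= am addr0.
rewrite /pairing aK am [atom (cut_tail _ _ _)]/= !mul0r !add0e -addeA [RHS]addeC.
congr (_ + _)%E.
rewrite -ge0_integralD//.
- by apply: eq_integral => x _; rewrite -EFinD -mulrDr addrC subrK.
- by move=> x Ix; rewrite lee_fin mulr_ge0 ?f0 ?dens_Kop_ge0.
- by apply/measurable_EFinP; apply: measurable_funM => //; exact: measurable_dens_Kop.
- by move=> x Ix; rewrite lee_fin mulr_ge0 ?f0 ?t0.
- by apply/measurable_EFinP; exact: measurable_funM.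
Qed.

Lemma heat_Kop t r C : 0 < t -> I01 r -> 0 <= C ->
  (forall x, I01 x -> Gneum t r x <= C) ->
  `|dens (heat t K) r - dens (heat t m) r| <= C * a.
Proof.
move=> t0 Ir C0 GC.
have := pairing_Kop (measurable_Gneum t (measurable_itv _) (measurable_cst r) (@measurable_id _ _ _)) (fun x _ => Gneum_ge0 t r x).
rewrite -(EFin_heat t0 pm Ir) -(EFin_heat t0 posmeas_Kop Ir) -(EFin_heat t0 posmeas_cut_tail Ir).
rewrite -!EFinD => E0; have E := EFin_inj E0; clear E0.
have h1 := heat_ub t0 posmeas_cut_tail Ir C0 GC.
have h2 := heat_ge0 r t0 posmeas_cut_tail.
have h3 : a * Gneum t r 0 <= C * a.
  by rewrite mulrC ler_wpM2r ?(ltW a0)// GC//= in_itv/= lexx ler01.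
have h4 : 0 <= a * Gneum t r 0 by rewrite mulr_ge0 ?Gneum_ge0 ?(ltW a0).
move: E h1 h2; move: (dens _ r) (dens _ r) (dens _ r) => x y z E h1 h2.
by rewrite ler_norml; apply/andP; split; lra.
Qed.

Lemma totvar_Kop_id : totvar K m = (2 * a)%:E.
Proof.
have := integral_dens posmeas_cut_tail; rewrite /= subr0 => E.
rewrite /totvar -[X in (_ + X)%E = _](_ : a%:E = _).
  by rewrite /= am !subr0 addr0 ger0_norm ?ltW// -EFinD; congr (_%:E); ring.
rewrite -E; apply: eq_integral => x /[!inE] Ix.
by rewrite distrC ger0_norm// subr_ge0 dens_Kop_le.
Qed.

End one_measure.

Definition diff_meas (m1 m2 : meas R) : meas R :=
  Meas `|atom m1 - atom m2| (fun x => `|dens m1 x - dens m2 x|).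

Lemma totvarC (m1 m2 : meas R) : totvar m1 m2 = totvar m2 m1.
Proof.
by rewrite /totvar distrC; congr (_ + _)%E; apply: eq_integral => x _; rewrite distrC.
Qed.

Lemma measurable_diff_meas M1 M2 (m1 m2 : meas R) : posmeas M1 m1 -> posmeas M2 m2 ->
  measurable_fun I01 (dens (diff_meas m1 m2)).
Proof.
move=> [_ md1 _ _] [_ md2 _ _].
by apply: measurableT_comp => //; exact: measurable_funB.
Qed.

Lemma totvar_le M1 M2 (m1 m2 : meas R) : posmeas M1 m1 -> posmeas M2 m2 ->
  (totvar m1 m2 <= (M1 + M2)%:E)%E.
Proof.
move=> p1 p2; have [a1 md1 d1 E1] := p1; have [a2 md2 d2 E2] := p2.
rewrite EFinD -E1 -E2 addeACA leeD//.
  rewrite -EFinD lee_fin; apply: le_trans (ler_normB _ _) _.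
  by rewrite !ger0_norm.
rewrite -ge0_integralD//; last 2 first.
- exact/measurable_EFinP.
- exact/measurable_EFinP.
apply: ge0_le_integral => //.
- by apply/measurable_EFinP; exact: measurable_diff_meas p1 p2.
- by apply: emeasurable_funD; exact/measurable_EFinP.
- move=> x Ix; rewrite -EFinD lee_fin; apply: le_trans (ler_normB _ _) _.
  by rewrite !ger0_norm ?d1 ?d2.
Qed.

Lemma totvar_ge0 (m1 m2 : meas R) : (0 <= totvar m1 m2)%E.
Proof. by rewrite adde_ge0// integral_ge0. Qed.

Lemma totvar_fin M1 M2 (m1 m2 : meas R) : posmeas M1 m1 -> posmeas M2 m2 ->
  totvar m1 m2 \is a fin_num.
Proof.
move=> p1 p2; rewrite ge0_fin_numE ?totvar_ge0//.
exact: le_lt_trans (totvar_le p1 p2) (ltry _).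
Qed.

Lemma posmeas_diff M1 M2 (m1 m2 : meas R) : posmeas M1 m1 -> posmeas M2 m2 ->
  posmeas (fine (totvar m1 m2)) (diff_meas m1 m2).
Proof.
move=> p1 p2; split.
- by rewrite /=.
- exact: measurable_diff_meas p1 p2.
- by move=> x _ /=.
- by rewrite fineK//; exact: totvar_fin p1 p2.
Qed.

Lemma totvar_triangle M1 M2 M3 (m1 m2 m3 : meas R) :
  posmeas M1 m1 -> posmeas M2 m2 -> posmeas M3 m3 ->
  (totvar m1 m3 <= totvar m1 m2 + totvar m2 m3)%E.
Proof.
move=> p1 p2 p3; rewrite /totvar addeACA leeD//.
  by rewrite -EFinD lee_fin ler_distD.
have m12 := measurable_diff_meas p1 p2; have m23 := measurable_diff_meas p2 p3.
rewrite -ge0_integralD//; last 2 first.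
- exact/measurable_EFinP.
- exact/measurable_EFinP.
apply: ge0_le_integral => //.
- by apply/measurable_EFinP; exact: measurable_diff_meas p1 p3.
- by apply: emeasurable_funD; exact/measurable_EFinP.
- by move=> x Ix; rewrite -EFinD lee_fin ler_distD.
Qed.

Lemma heat_diff_le M1 M2 t r (m1 m2 : meas R) : 0 < t -> I01 r ->
  posmeas M1 m1 -> posmeas M2 m2 ->
  dens (heat t m1) r <= dens (heat t m2) r + dens (heat t (diff_meas m1 m2)) r.
Proof.
move=> t0 Ir p1 p2; have p12 := posmeas_diff p1 p2.
suff : (pairing m1 (Gneum t r) <= pairing m2 (Gneum t r) +
    pairing (diff_meas m1 m2) (Gneum t r))%E.
  by rewrite -(EFin_heat t0 p1 Ir) -(EFin_heat t0 p2 Ir) -(EFin_heat t0 p12 Ir) -EFinD lee_fin.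
have [a1 md1 d1 _] := p1; have [a2 md2 d2 _] := p2; have [_ md12 _ _] := p12.
have mG : measurable_fun I01 (Gneum t r) by exact: measurable_Gneum.
rewrite /pairing addeACA leeD//.
  rewrite -EFinD lee_fin -mulrDl ler_wpM2r ?Gneum_ge0//=.
  by have := ler_norm (atom m1 - atom m2); lra.
rewrite -ge0_integralD//; last 4 first.
- by move=> x Ix; rewrite lee_fin mulr_ge0 ?Gneum_ge0 ?d2.
- by apply/measurable_EFinP; exact: measurable_funM.
- by move=> x Ix; rewrite lee_fin mulr_ge0 ?Gneum_ge0//=.
- by apply/measurable_EFinP; exact: measurable_funM.
apply: ge0_le_integral => //.
- by move=> x Ix; rewrite lee_fin mulr_ge0 ?Gneum_ge0 ?d1.
- by apply/measurable_EFinP; exact: measurable_funM.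
- by apply: emeasurable_funD; apply/measurable_EFinP; exact: measurable_funM.
- move=> x Ix; rewrite -EFinD lee_fin -mulrDr ler_wpM2l ?Gneum_ge0//=.
  by have := ler_norm (dens m1 x - dens m2 x); lra.
Qed.

Lemma totvar_heat M1 M2 t (m1 m2 : meas R) : 0 < t ->
  posmeas M1 m1 -> posmeas M2 m2 ->
  (totvar (heat t m1) (heat t m2) <= totvar m1 m2)%E.
Proof.
move=> t0 p1 p2; have p12 := posmeas_heat t0 (posmeas_diff p1 p2).
have [_ md12 _] := p12; rewrite fineK; last exact: totvar_fin p1 p2.
move=> <-; rewrite /totvar [atom _]/= [atom (heat t m2)]/= subr0 normr0 leeD2l//.
apply: ge0_le_integral => //.
- apply/measurable_EFinP.
  exact: measurable_diff_meas (posmeas_heat t0 p1) (posmeas_heat t0 p2).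
- exact/measurable_EFinP.
- move=> x Ix; rewrite lee_fin ler_distl.
  have := heat_diff_le t0 Ix p1 p2; have := heat_diff_le t0 Ix p2 p1.
  have -> : diff_meas m2 m1 = diff_meas m1 m2.
    by rewrite /diff_meas distrC; congr Meas; apply/funext => y; rewrite distrC.
  move: (dens _ x) (dens _ x) (dens _ x) => p q s h1 h2.
  by apply/andP; split; lra.
Qed.

(* Cutting more mass than the other measure costs at most the mass already missing there:
   pointwise, [|k1 - k2| + (rho2 - k2) <= |rho1 - rho2| + (rho1 - k1)]. *)
Lemma totvar_Kop M1 M2 j delta (m1 m2 : meas R) :
  posmeas M1 m1 -> posmeas M2 m2 -> atom m1 = 0 -> atom m2 = 0 ->
  0 < j * delta -> j * delta < M1 -> j * delta < M2 ->
  (totvar (Kop j delta m1) (Kop j delta m2) <= totvar m1 m2)%E.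
Proof.
wlog le : M1 M2 m1 m2 / Rdel j delta m1 <= Rdel j delta m2.
  have [h|/ltW h] := leP (Rdel j delta m1) (Rdel j delta m2) => H p1 p2 am1 am2 a0 aM1 aM2.
    exact: (H M1 M2).
  by rewrite totvarC [leRHS]totvarC; exact: (H M2 M1).
move=> p1 p2 am1 am2 a0 aM1 aM2.
have [_ md1 d1 _] := p1; have [_ md2 d2 _] := p2.
have pt1 := posmeas_cut_tail p1 am1 a0 aM1; have pt2 := posmeas_cut_tail p2 am2 a0 aM2.
have [_ mt1 t1 _] := pt1; have [_ mt2 t2 _] := pt2.
have pk1 := posmeas_Kop p1 am1 a0 aM1; have pk2 := posmeas_Kop p2 am2 a0 aM2.
have mk := measurable_diff_meas pk1 pk2; have m12 := measurable_diff_meas p1 p2.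
have ak1 : atom (Kop j delta m1) = j * delta by rewrite /= am1 addr0.
have ak2 : atom (Kop j delta m2) = j * delta by rewrite /= am2 addr0.
rewrite /totvar ak1 ak2 am1 am2 !subrr !normr0 !add0e.
have I1 : (\int[mu]_(x in I01) (dens m1 x - dens (Kop j delta m1) x)%:E = (j * delta)%:E)%E.
  by have := integral_dens pt1; rewrite subr0.
have I2 : (\int[mu]_(x in I01) (dens m2 x - dens (Kop j delta m2) x)%:E = (j * delta)%:E)%E.
  by have := integral_dens pt2; rewrite subr0.
rewrite -(leeD2rE _ _ (x := (j * delta)%:E))// -{1}I2 -I1.
rewrite -!ge0_integralD//; try exact/measurable_EFinP.
apply: ge0_le_integral => //.
- by move=> x Ix; rewrite adde_ge0// lee_fin t2.
- by apply: emeasurable_funD; exact/measurable_EFinP.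
- by apply: emeasurable_funD; exact/measurable_EFinP.
- move=> x Ix; rewrite -!EFinD lee_fin.
  have h1 := d1 x Ix; have h2 := d2 x Ix.
  have n1 := normr_ge0 (dens m1 x - dens m2 x).
  have n2 := ler_norm (dens m2 x - dens m1 x); rewrite distrC in n2.
  rewrite !(dens_Kop _ _ _ Ix).
  case: (leP x (Rdel j delta m1)) => x1; case: (leP x (Rdel j delta m2)) => x2;
    rewrite ?subrr ?subr0 ?sub0r ?normrN ?normr0 ?(ger0_norm h1) ?(ger0_norm h2); lra.
Qed.

End cut_operator_theory.

(** * Barriers *)

Section barriers.
Context {R : realType}.
Local Notation mu := (@lebesgue_measure R).
Local Notation I01 := (`[0, 1]%classic : set R).
Local Notation A := (@kernel_const R 1).
Implicit Types (m : meas R) (M t r j delta : R) (n k : nat).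

Lemma Fm_posmeas M m : posmeas M m -> Fm 0 m = M%:E.
Proof. by case=> _ _ _ E; rewrite /Fm lexx setIid. Qed.

Lemma Splus_add j delta n k m :
  Splus j delta (n + k) m = Splus j delta n (Splus j delta k m).
Proof. by elim: n => //= n ->. Qed.

Lemma Sminus_Splus j delta n m :
  Sminus j delta n.+1 m = Kop j delta (Splus j delta n (heat delta m)).
Proof.
elim: n => [//|n IH].
exact: (congr1 (fun w => Kop j delta (heat delta w)) IH).
Qed.

Lemma Splus_Sminus j delta n m :
  Splus j delta n.+1 m = heat delta (Sminus j delta n (Kop j delta m)).
Proof.
elim: n => [//|n IH].
exact: (congr1 (fun w => heat delta (Kop j delta w)) IH).
Qed.

Lemma ex_first_multiple e delta n : 0 < e -> e <= n%:R * delta ->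
  exists k, [/\ (k < n)%N, e <= k.+1%:R * delta & k%:R * delta < e].
Proof.
move=> e0; elim: n => [|n IH]; first by rewrite mul0r leNgt e0.
have [/IH[k [kn h1 h2]] _|h1 h2] := leP e (n%:R * delta); last by exists n.
by exists k; split=> //; exact: ltnW.
Qed.

Lemma sqrt_step (x y : R) : 0 <= x -> x < y ->
  2 * Num.sqrt x + (y - x) / Num.sqrt y <= 2 * Num.sqrt y.
Proof.
move=> x0 xy; have y0 : 0 < y by exact: le_lt_trans xy.
have q0 : 0 < Num.sqrt y by rewrite sqrtr_gt0.
have p0 := sqrtr_ge0 x.
have pq : Num.sqrt x <= Num.sqrt y by rewrite ler_wsqrtr// ltW.
rewrite -[X in (X - _) / _](sqr_sqrtr (ltW y0)) -[X in (_ - X) / _](sqr_sqrtr x0).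
move: (Num.sqrt x) (Num.sqrt y) q0 p0 pq => p q q0 p0 pq.
rewrite -lerBrDl ler_pdivrMr//.
have : 0 <= (q - p) * (q - p) by rewrite mulr_ge0 ?subr_ge0.
nra.
Qed.

Lemma ex_small_sqrt (c z T : R) : 0 <= c -> 0 < z -> 0 < T ->
  exists t, [/\ 0 < t, t <= T & c * Num.sqrt t <= z].
Proof.
move=> c0 z0 T0; pose s := z / (c + 1).
have c1 : 0 < c + 1 by rewrite ltr_wpDl.
have s0 : 0 < s by rewrite divr_gt0.
exists (Num.min T (s ^+ 2)); split.
- by rewrite lt_min T0 exprn_gt0.
- by rewrite ge_min lexx.
- apply: (@le_trans _ _ (c * s)).
    rewrite ler_wpM2l// -[leRHS]ger0_norm ?(ltW s0)// -sqrtr_sqr ler_wsqrtr//.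
    by rewrite ge_min lexx orbT.
  by rewrite /s mulrA ler_pdivrMr// mulrDr mulr1 mulrC lerDl ltW.
Qed.

Lemma kernel_const1_ge0 : 0 <= A.
Proof. by rewrite ltW// kernel_const_gt0. Qed.

Section one_barrier.
Variables (M j delta : R).
Hypotheses (j0 : 0 < j) (delta0 : 0 < delta) (aM : j * delta < M).

Let a0 : 0 < j * delta. Proof. exact: mulr_gt0. Qed.

Lemma twoAj_ge0 : 0 <= 2 * A * j.
Proof.
apply: mulr_ge0; last exact: ltW.
by apply: mulr_ge0 => //; exact: kernel_const1_ge0.
Qed.

Lemma Aj_ge0 : 0 <= A * j.
Proof. by apply: mulr_ge0; [exact: kernel_const1_ge0|exact: ltW]. Qed.

Lemma posmeas_Splus n m : posmeas M m -> atom m = 0 ->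
  posmeas M (Splus j delta n m) /\ atom (Splus j delta n m) = 0.
Proof.
move=> pm am; elim: n => // n [pn an]; split => //.
by apply: posmeas_heat => //; exact: posmeas_Kop.
Qed.

Lemma posmeas_Sminus n m : posmeas M m -> posmeas M (Sminus j delta n m).
Proof.
move=> pm; elim: n => // n pn; apply: posmeas_Kop => //.
exact: posmeas_heat.
Qed.

(* Duhamel: each cut of mass [j * delta], transported for a time [i * delta], perturbs the
   density by at most [A * j * delta / sqrt (i * delta)], which sums to [2 A j sqrt (k * delta)]. *)
Lemma Splus_heat k m r : posmeas M m -> atom m = 0 -> k%:R * delta <= 1 -> I01 r ->
  `|dens (Splus j delta k.+1 m) r - dens (heat (k.+1%:R * delta) (Kop j delta m)) r|
    <= 2 * A * j * Num.sqrt (k%:R * delta).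
Proof.
move=> pm am kd Ir; elim: k m pm am kd => [|k IH] m pm am kd.
  by rewrite mul1r subrr normr0 mulr_ge0 ?twoAj_ge0.
have pK := posmeas_Kop pm am a0 aM.
set m' := heat delta (Kop j delta m).
have pm' : posmeas M m' by exact: posmeas_heat.
have am' : atom m' = 0 by [].
rewrite -addn1 Splus_add -/m'.
have kd' : k%:R * delta <= 1 by apply: le_trans kd; rewrite ler_pM2r// ler_nat.
have t0 : 0 < k.+1%:R * delta by rewrite mulr_gt0.
have h1 := IH m' pm' am' kd'.
have C0 : 0 <= A / Num.sqrt (k.+1%:R * delta).
  by rewrite divr_ge0 ?sqrtr_ge0 ?kernel_const1_ge0.
have h2 := heat_Kop pm' am' a0 aM t0 Ir C0 (fun x Ix => Gneum_le t0 kd Ir Ix).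
have h3 := heat_heat t0 delta0 pK Ir.
rewrite -/m' in h3.
have e3 : k.+1%:R * delta + delta = (k.+1 + 1)%:R * delta by rewrite natrD; ring.
rewrite e3 in h3; rewrite -h3.
have st : 2 * Num.sqrt (k%:R * delta) + delta / Num.sqrt (k.+1%:R * delta) <=
    2 * Num.sqrt (k.+1%:R * delta).
  have := @sqrt_step (k%:R * delta) (k.+1%:R * delta).
  have -> : k.+1%:R * delta - k%:R * delta = delta by rewrite -natr1; ring.
  by apply; rewrite ?mulr_ge0 ?(ltW delta0)// ltr_pM2r// ltr_nat.
have st' : A * j * (2 * Num.sqrt (k%:R * delta) + delta / Num.sqrt (k.+1%:R * delta)) <=
    A * j * (2 * Num.sqrt (k.+1%:R * delta)).
  by rewrite ler_wpM2l// Aj_ge0.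
move: h1 h2.
move: (dens (Splus j delta k.+1 m') r) (dens (heat _ (Kop j delta m')) r) (dens (heat _ m') r).
move=> x y z h1 h2.
apply: le_trans (ler_distD y _ _) _; apply: le_trans (lerD h1 h2) _.
move: st'; rewrite mulrDr; lra.
Qed.

Lemma Splus_ub_short n m r B : posmeas M m -> atom m = 0 -> 0 <= B ->
  {ae mu, forall x, I01 x -> dens m x <= B} -> n.+1%:R * delta <= 1 -> I01 r ->
  dens (Splus j delta n.+1 m) r <= B + 3 * A * j.
Proof.
move=> pm am B0 mB nd Ir.
have nd' : n%:R * delta <= 1 by apply: le_trans nd; rewrite ler_pM2r// ler_nat.
have t0 : 0 < n.+1%:R * delta by rewrite mulr_gt0.
have A0 := kernel_const1_ge0.
have C0 : 0 <= A / Num.sqrt (n.+1%:R * delta) by rewrite divr_ge0 ?sqrtr_ge0.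
have h1 := Splus_heat pm am nd' Ir.
have h2 := heat_Kop pm am a0 aM t0 Ir C0 (fun x Ix => Gneum_le t0 nd Ir Ix).
have h3 := heat_le_ae t0 pm am Ir B0 mB.
have Aj0 := Aj_ge0.
have s1 : 2 * A * j * Num.sqrt (n%:R * delta) <= 2 * (A * j).
  rewrite mulrA ler_piMr ?twoAj_ge0//.
  by rewrite -[leRHS]sqrtr1 ler_wsqrtr.
have s2 : A / Num.sqrt (n.+1%:R * delta) * (j * delta) <= A * j.
  have -> : A / Num.sqrt (n.+1%:R * delta) * (j * delta) =
    A * j * (delta / Num.sqrt (n.+1%:R * delta)) by ring.
  rewrite -[leRHS]mulr1 ler_wpM2l// ler_pdivrMr ?sqrtr_gt0// mul1r.
  apply: (@le_trans _ _ (n.+1%:R * delta)).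
    by rewrite ler_peMl ?(ltW delta0)// ler1n.
  rewrite -{1}(sqr_sqrtr (ltW t0)) expr2 ler_piMl ?sqrtr_ge0//.
  by rewrite -[leRHS]sqrtr1 ler_wsqrtr.
move: h1 h2 h3; rewrite !ler_norml => /andP[_ h1] /andP[_ h2] h3.
move: h1 h2 h3; move: (dens _ r) (dens _ r) (dens _ r) => x y z h1 h2 h3.
lra.
Qed.

Lemma Splus_heat_restart e n m : posmeas M m -> atom m = 0 -> 0 < e -> e <= 1 ->
  e <= n%:R * delta -> exists t, exists w,
  [/\ e <= t, posmeas M w & forall r, I01 r ->
   `|dens (Splus j delta n m) r - dens (heat t w) r| <= 2 * A * j * Num.sqrt e].
Proof.
move=> pm am e0 e1 en; have [k [kn ek ke]] := ex_first_multiple e0 en.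
have [pn an] := posmeas_Splus (n - k.+1) pm am.
exists (k.+1%:R * delta), (Kop j delta (Splus j delta (n - k.+1) m)); split => //.
  exact: posmeas_Kop.
move=> r Ir; rewrite -{1}(subnKC kn) Splus_add.
apply: le_trans (Splus_heat pn an _ Ir) _; first by rewrite (le_trans (ltW ke)).
rewrite ler_wpM2l ?ler_wsqrtr ?(ltW ke)//.
exact: twoAj_ge0.
Qed.

Definition long_const : R := kernel_const 2^-1 / Num.sqrt 2^-1.

Lemma long_const_ge0 : 0 <= long_const.
Proof. by rewrite divr_ge0 ?sqrtr_ge0// ltW// kernel_const_gt0. Qed.

Lemma heat_ub_long t m r : posmeas M m -> 2^-1 <= t -> I01 r ->
  dens (heat t m) r <= long_const * M.
Proof.
move=> pm t2 Ir; have h2 : (0 : R) < 2^-1 by rewrite invr_gt0.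
apply: heat_ub => //; [exact: lt_le_trans t2|exact: long_const_ge0|move=> x Ix].
exact: Gneum_le_after.
Qed.

Lemma Splus_ub_long n m r : posmeas M m -> atom m = 0 -> 2^-1 <= n%:R * delta -> I01 r ->
  dens (Splus j delta n m) r <= long_const * M + 2 * A * j.
Proof.
move=> pm am nd Ir; have h2 : (0 : R) < 2^-1 by rewrite invr_gt0.
have h21 : (2^-1 : R) <= 1 by rewrite invf_le1// ler1n.
have [t [w [et pw H]]] := Splus_heat_restart pm am h2 h21 nd.
have h := heat_ub_long pw et Ir.
have := H r Ir; rewrite ler_norml => /andP[_ h1].
have s1 : 2 * A * j * Num.sqrt 2^-1 <= 2 * A * j.
  rewrite ler_piMr ?twoAj_ge0//.
  by rewrite -[leRHS]sqrtr1 ler_wsqrtr.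
move: h h1; move: (dens _ r) (dens _ r) => x y h1 h3.
lra.
Qed.

Lemma totvar_Sminus n m1 m2 : posmeas M m1 -> posmeas M m2 ->
  (totvar (Sminus j delta n m1) (Sminus j delta n m2) <= totvar m1 m2)%E.
Proof.
move=> p1 p2; elim: n => // n IH.
have q1 := posmeas_Sminus n p1; have q2 := posmeas_Sminus n p2.
apply: le_trans IH; apply: le_trans (totvar_heat delta0 q1 q2).
by apply: (totvar_Kop (posmeas_heat delta0 q1) (posmeas_heat delta0 q2)).
Qed.

Lemma totvar_barriers n m : posmeas M m -> atom m = 0 ->
  (totvar (Splus j delta n.+1 m) (Sminus j delta n.+1 m) <= (4 * j * delta)%:E)%E.
Proof.
move=> pm am; have pK := posmeas_Kop pm am a0 aM.
have [pw aw] := posmeas_Splus n.+1 pm am.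
have pKw := posmeas_Kop pw aw a0 aM.
apply: le_trans (totvar_triangle pw pKw (posmeas_Sminus n.+1 pm)) _.
have -> : 4 * j * delta = 2 * (j * delta) + 2 * (j * delta) by ring.
rewrite EFinD leeD//.
  by rewrite totvarC (totvar_Kop_id pw aw a0 aM).
rewrite -(totvar_Kop_id pm am a0 aM) Splus_Sminus.
exact: (totvar_Sminus n.+1 pK pm).
Qed.

End one_barrier.

End barriers.

Section equicontinuity.
Context {R : realType}.
Local Notation mu := (@lebesgue_measure R).
Local Notation I01 := (`[0, 1]%classic : set R).
Local Notation A := (@kernel_const R 1).

Lemma Splus_equicontinuous (M j sigma zeta : R) (m : meas R) :
  0 < j -> 0 < sigma -> 0 < zeta -> posmeas M m -> atom m = 0 ->
  exists tau, exists d, [/\ 0 < tau, 0 < d &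
  forall delta, 0 < delta -> j * delta < M ->
  forall n n' : nat, sigma <= n%:R * delta -> n%:R * delta < n'%:R * delta ->
  n'%:R * delta < n%:R * delta + tau ->
  forall r r', I01 r -> I01 r' -> `|r - r'| < d ->
  `|dens (Splus j delta n m) r - dens (Splus j delta n m) r'| < zeta /\
  `|dens (Splus j delta n' m) r - dens (Splus j delta n m) r| < zeta].
Proof.
move=> j0 sigma0 zeta0 pm am.
have Aj0 : 0 <= A * j := Aj_ge0 j0.
have AAj0 : 0 <= 2 * A * j := twoAj_ge0 j0.
have z8 : 0 < zeta / 8 by rewrite divr_gt0.
have T0 : 0 < Num.min 1 sigma by rewrite lt_min ltr01.
have [e [e0 eT e8]] := ex_small_sqrt AAj0 z8 T0.
have [e1 es] : e <= 1 /\ e <= sigma by move: eT; rewrite le_min => /andP[].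
have [L L0 HL] := heat_lipschitz e0 pm.
have c0 : 0 <= 3 * (A * j) + 2 * L by apply: addr_ge0; apply: mulr_ge0.
have [tau [tau0 tau1 tau8]] := ex_small_sqrt c0 z8 (@ltr01 R).
have L1 : 0 < L + 1 by rewrite ltr_wpDl.
exists tau, (zeta / 8 / (L + 1)); split => //; first by rewrite divr_gt0.
move=> delta delta0 aM n n' sn nn' n't r r' Ir Ir' rr'.
have a0 : 0 < j * delta by exact: mulr_gt0.
have [t [w [et pw Hw]]] := Splus_heat_restart j0 delta0 aM pm am e0 e1 (le_trans es sn).
have [pn an] := posmeas_Splus j0 delta0 aM n pm am.
have osc x y : I01 x -> I01 y ->
    `|dens (Splus j delta n m) x - dens (Splus j delta n m) y| <= zeta / 4 + L * `|x - y|.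
  move=> Ix Iy; have := Hw _ Ix; have := Hw _ Iy; have := HL t x y w et pw Ix Iy.
  move: (dens (heat t w) x) (dens (heat t w) y) (dens _ x) (dens _ y) => a b p q.
  rewrite !ler_norml => /andP[h1 h2] /andP[h3 h4] /andP[h5 h6].
  by apply/andP; split; lra.
have Ld : L * (zeta / 8 / (L + 1)) <= zeta / 8.
  by rewrite mulrA ler_pdivrMr// mulrC ler_wpM2l ?(ltW z8)//; lra.
split.
  apply: le_lt_trans (osc _ _ Ir Ir') _.
  have : L * `|r - r'| <= L * (zeta / 8 / (L + 1)) by rewrite ler_wpM2l// ltW.
  lra.
have nn'' : (n < n')%N by move: nn'; rewrite ltr_pM2r// ltr_nat.
pose p := (n' - n.+1)%N.
have En' : n' = (p.+1 + n)%N by rewrite /p addSnnS subnK.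
have ptau : p.+1%:R * delta < tau.
  by move: n't; rewrite En' natrD mulrDl addrC ltrD2l.
have p0 : 0 < p.+1%:R * delta by rewrite mulr_gt0.
have pltau : p%:R * delta <= tau.
  by apply: le_trans (ltW ptau); rewrite ler_pM2r// ler_nat.
have p1 : p.+1%:R * delta <= 1 by exact: le_trans (ltW ptau) tau1.
rewrite En' Splus_add.
have C0 : 0 <= A / Num.sqrt (p.+1%:R * delta).
  by apply: divr_ge0; [exact: kernel_const1_ge0|exact: sqrtr_ge0].
have h1 := Splus_heat j0 delta0 aM pn an (le_trans pltau tau1) Ir.
have h2 := heat_Kop pn an a0 aM p0 Ir C0 (fun x Ix => Gneum_le p0 p1 Ir Ix).
have osc' x : I01 x ->
    `|dens (Splus j delta n m) x - dens (Splus j delta n m) r| <= zeta / 4 + L * `|r - x|.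
  by move=> Ix; rewrite (distrC r x); exact: osc.
have z4 : 0 <= zeta / 4 by rewrite divr_ge0// ltW.
have h3 := heat_near_id p0 pn an Ir z4 L0 osc'.
have st0 := sqrtr_ge0 tau.
have s1 : 2 * A * j * Num.sqrt (p%:R * delta) <= 2 * A * j * Num.sqrt tau.
  by rewrite ler_wpM2l// ler_wsqrtr.
have s2 : A / Num.sqrt (p.+1%:R * delta) * (j * delta) <= A * j * Num.sqrt tau.
  have -> : A / Num.sqrt (p.+1%:R * delta) * (j * delta) =
    A * j * (delta / Num.sqrt (p.+1%:R * delta)) by ring.
  rewrite ler_wpM2l// ler_pdivrMr ?sqrtr_gt0//.
  apply: (@le_trans _ _ (p.+1%:R * delta)).
    by rewrite ler_peMl ?(ltW delta0)// ler1n.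
  rewrite -{1}(sqr_sqrtr (ltW p0)) expr2 ler_wpM2r ?sqrtr_ge0//.
  by rewrite ler_wsqrtr// ltW.
have s3 : L * Num.sqrt (2 * (p.+1%:R * delta)) <= L * (2 * Num.sqrt tau).
  rewrite ler_wpM2l// sqrtrM// ler_pM ?sqrtr_ge0//; last by rewrite ler_wsqrtr// ltW.
  rewrite -[leRHS]ger0_norm// -sqrtr_sqr ler_wsqrtr//; lra.
have final : zeta / 4 + zeta / 8 < zeta by lra.
move: h1 h2 h3.
move: (dens _ r) (dens (heat _ _) r) (dens (heat _ (Kop _ _ _)) r) (dens (Splus j delta p.+1 _) r).
move=> v z y x; rewrite !ler_norml ltr_norml => /andP[h1 h2] /andP[h3 h4] /andP[h5 h6].
by apply/andP; split; lra.
Qed.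

End equicontinuity.

Section sup_norm.
Context {R : realType}.
Local Notation mu := (@lebesgue_measure R).
Local Notation I01 := (`[0, 1]%classic : set R).

Lemma normInf_le (f : R -> R) c : (forall x, I01 x -> 0 <= f x <= c) ->
  (normInf f <= c%:E)%E.
Proof.
move=> fc; apply: ereal_inf_lbound => /=; apply: aeW => x Ix.
by have /andP[f0 fxc] := fc x Ix; rewrite lee_fin ger0_norm.
Qed.

Lemma normInf_ae (f : R -> R) b : (normInf f < b%:E)%E ->
  {ae mu, forall x, I01 x -> f x <= b}.
Proof.
move=> /ereal_inf_lt[M /= aeM Mb]; move: aeM.
apply: (@filterS _ _ (ae_filter_ringOfSetsType mu)) => x H Ix.
rewrite -lee_fin; apply: le_trans (le_trans (H Ix) (ltW Mb)).
by rewrite lee_fin ler_norm.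
Qed.

Lemma integral_le_ae (f : R -> R) b : measurable_fun I01 f ->
  (forall x, I01 x -> 0 <= f x) -> 0 <= b -> {ae mu, forall x, I01 x -> f x <= b} ->
  (\int[mu]_(x in I01) (f x)%:E <= b%:E)%E.
Proof.
move=> mf f0 b0 fb.
have -> : (b%:E = \int[mu]_(x in I01) (cst b%:E) x)%E.
  transitivity (b%:E * mu I01)%E; last by rewrite integral_cst.
  by rewrite lebesgue_measure_itv/= lte_fin ltr01 oppr0 adde0 mule1.
by apply: ae_ge0_le_integral => //; exact/measurable_EFinP.
Qed.

Lemma Fm_ofFun (u : R -> R) : Fm 0 (ofFun u) = (\int[mu]_(x in I01) (u x)%:E)%E.
Proof. by rewrite /Fm lexx setIid add0e. Qed.

Lemma posmeas_ofFun (u : R -> R) : measurable_fun I01 u ->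
  (forall x, I01 x -> 0 <= u x) -> (normInf u < +oo)%E ->
  posmeas (fine (Fm 0 (ofFun u))) (ofFun u).
Proof.
move=> mu_ u0 uoo.
have [b b0 ub] : exists2 b, 0 <= b & (normInf u < b%:E)%E.
  case: (normInf u) uoo => [s|//|] _; last by exists 0; rewrite ?ltNyr.
  by exists (`|s| + 1); rewrite ?addr_ge0// lte_fin; have := ler_norm s; lra.
split => //; rewrite add0e fineK Fm_ofFun// ge0_fin_numE.
  exact: le_lt_trans (integral_le_ae mu_ u0 b0 (normInf_ae ub)) (ltry _).
by apply: integral_ge0 => x Ix; rewrite lee_fin u0.
Qed.

Lemma normInf_ge0 (u : R -> R) : measurable_fun I01 u ->
  (forall x, I01 x -> 0 <= u x) -> (0 < Fm 0 (ofFun u))%E -> (0 <= normInf u)%E.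
Proof.
move=> mu_ u0; rewrite Fm_ofFun leNgt => Fpos; apply/negP => /normInf_ae uae.
by have := integral_le_ae mu_ u0 (lexx _) uae; rewrite leNgt Fpos.
Qed.

End sup_norm.

Unset Implicit Arguments.

Theorem mainTheorem11 (R : realType) (j : R) (u : R -> R)
  (hj : 0 < j)
  (hmeas : measurable_fun (`[0, 1] : set R) u)
  (hpos : forall x, `[0, 1]%classic x -> 0 <= u x)
  (hbdd : (normInf u < +oo)%E)
  (hmass : (0 < Fm 0 (ofFun u))%E) :
  (* (i) *)
  (forall delta : R, 0 < delta -> ((j * delta)%:E < Fm 0 (ofFun u))%E ->
     forall n : nat,
       Fm 0 (Splus j delta n (ofFun u)) = Fm 0 (ofFun u) /\
       Fm 0 (Sminus j delta n (ofFun u)) = Fm 0 (ofFun u)) /\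
  (* (ii) *)
  (exists c : R,
     forall delta : R, 0 < delta -> ((j * delta)%:E < Fm 0 (ofFun u))%E ->
     forall n : nat,
       (n%:R * delta <= 1 ->
          (normInf (dens (Splus j delta n (ofFun u))) <= c%:E * (j%:E + normInf u))%E /\
          ((0 < n)%N ->
            (normInf (dens (Sminus j delta n (ofFun u))) <= c%:E * (j%:E + normInf u))%E)) /\
       (1 < n%:R * delta ->
          (normInf (dens (Splus j delta n (ofFun u))) <= c%:E * (j%:E + Fm 0 (ofFun u)))%E /\
          (normInf (dens (Sminus j delta n (ofFun u))) <= c%:E * (j%:E + Fm 0 (ofFun u)))%E)) /\
  (* (iii) *)
  (forall sigma : R, 0 < sigma ->
   forall zeta : R, 0 < zeta ->
   exists tau : R, exists d : R, 0 < tau /\ 0 < d /\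
     forall delta : R, 0 < delta -> delta < sigma ->
       ((j * delta)%:E < Fm 0 (ofFun u))%E ->
     forall n n' : nat, sigma <= n%:R * delta ->
       n%:R * delta < n'%:R * delta -> n'%:R * delta < n%:R * delta + tau ->
     forall r r' : R, `[0, 1]%classic r -> `[0, 1]%classic r' -> `|r - r'| < d ->
       `|dens (Splus j delta n (ofFun u)) r - dens (Splus j delta n (ofFun u)) r'| < zeta /\
       `|dens (Splus j delta n' (ofFun u)) r - dens (Splus j delta n (ofFun u)) r| < zeta) /\
  (* (iv) *)
  (forall delta : R, 0 < delta -> ((j * delta)%:E < Fm 0 (ofFun u))%E ->
     forall n : nat, (0 < n)%N ->
       (totvar (Splus j delta n (ofFun u)) (Sminus j delta n (ofFun u))
          <= (4 * j * delta)%:E)%E).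
Proof.
have pu := posmeas_ofFun hmeas hpos hbdd.
set M := fine (Fm 0 (ofFun u)) in pu.
have FM : Fm 0 (ofFun u) = M%:E by exact: Fm_posmeas pu.
have au : atom (ofFun u) = 0 by [].
have N0 := normInf_ge0 hmeas hpos hmass.
have massE delta : ((j * delta)%:E < Fm 0 (ofFun u))%E -> j * delta < M.
  by rewrite FM lte_fin.
have M0 : 0 <= M by exact: posmeas_mass_ge0 pu.
split; [|split; [|split]].
- move=> delta delta0 /massE aM n; rewrite FM; split.
    by have [pn _] := posmeas_Splus hj delta0 aM n pu au; exact: Fm_posmeas pn.
  exact: Fm_posmeas (posmeas_Sminus hj delta0 aM n pu).
- have [N NE] : exists N, normInf u = N%:E.
    by exists (fine (normInf u)); rewrite fineK// ge0_fin_numE.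
  have N0' : 0 <= N by rewrite -lee_fin -NE.
  have uae e : 0 < e -> {ae @lebesgue_measure R, forall x, `[0, 1]%classic x -> u x <= N + e}.
    by move=> e0; apply: normInf_ae; rewrite NE lte_fin ltrDl.
  set A := @kernel_const R 1; set C := @long_const R.
  have A0 : 0 <= A by exact: kernel_const1_ge0.
  have C0 : 0 <= C by exact: long_const_ge0.
  have Aj0 : 0 <= A * j by exact: Aj_ge0.
  have CM0 : 0 <= C * M by exact: mulr_ge0.
  have AN0 : 0 <= A * N by exact: mulr_ge0.
  have CN0 : 0 <= C * N by exact: mulr_ge0.
  have Cj0 : 0 <= C * j by apply: mulr_ge0 => //; exact: ltW.
  have AM0 : 0 <= A * M by exact: mulr_ge0.
  exists (1 + 3 * A + C) => delta delta0 aM' n; have aM := massE _ aM'.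
  have [pn an] := posmeas_Splus hj delta0 aM n pu au.
  have pmn := posmeas_Sminus hj delta0 aM n pu.
  have [_ _ dn0 _] := pn; have [_ _ dmn0 _] := pmn.
  have ph : posmeas M (heat delta (ofFun u)) by exact: posmeas_heat.
  have minus_le k r : `[0, 1]%classic r -> dens (Sminus j delta k.+1 (ofFun u)) r <=
      dens (Splus j delta k (heat delta (ofFun u))) r.
    move=> Ir; rewrite Sminus_Splus.
    by have [pk _] := posmeas_Splus hj delta0 aM k ph erefl; exact: (dens_Kop_le _ _ pk).
  rewrite NE FM; split => [nd|nd].
    have short (f : R -> R) : (forall x, `[0, 1]%classic x -> 0 <= f x) ->
        (forall e x, 0 < e -> `[0, 1]%classic x -> f x <= N + e + 3 * A * j) ->
        (normInf f <= (1 + 3 * A + C)%:E * (j%:E + N%:E))%E.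
      move=> f0 fe; rewrite -EFinD -EFinM; apply: normInf_le => x Ix; rewrite f0//=.
      apply/ler_addgt0Pr => e e0; have := fe e x e0 Ix; lra.
    split.
      case: n nd pn dn0 {an pmn dmn0} => [|n] nd pn dn0.
        by rewrite /= NE -EFinD -EFinM lee_fin; lra.
      apply: short => // e x e0 Ix; apply: (Splus_ub_short hj delta0 aM pu au) => //.
        by rewrite addr_ge0// ltW.
      exact: uae.
    case: n nd pmn dmn0 {an pn dn0} => // n nd pmn dmn0 _.
    apply: short => // e x e0 Ix; apply: le_trans (minus_le n x Ix) _.
    have Ne0 : 0 <= N + e by rewrite addr_ge0// ltW.
    have hub y : `[0, 1]%classic y -> dens (heat delta (ofFun u)) y <= N + e.
      by move=> Iy; apply: (heat_le_ae delta0 pu) => //; exact: uae.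
    case: n nd {pmn dmn0} => [|n] nd.
      by apply: le_trans (hub x Ix) _; rewrite lerDl; lra.
    apply: (Splus_ub_short hj delta0 aM ph) => //; first exact: aeW.
    by apply: le_trans nd; rewrite ler_pM2r// ler_nat.
  have long (f : R -> R) : (forall x, `[0, 1]%classic x -> 0 <= f x) ->
      (forall x, `[0, 1]%classic x -> f x <= C * M + 2 * A * j) ->
      (normInf f <= (1 + 3 * A + C)%:E * (j%:E + M%:E))%E.
    move=> f0 fe; rewrite -EFinD -EFinM; apply: normInf_le => x Ix; rewrite f0//=.
    have := fe x Ix; lra.
  split; apply: long => // x Ix.
    by apply: (Splus_ub_long hj delta0 aM pu) => //; lra.
  case: n nd {pn an dn0 pmn dmn0} => [|n] nd; first by move: nd; rewrite mul0r; lra.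
  apply: le_trans (minus_le n x Ix) _.
  case: n nd => [|n] nd.
    have d1 : 2^-1 <= delta by move: nd; rewrite mul1r; lra.
    have := heat_ub_long pu d1 Ix; rewrite -/C /=; lra.
  apply: (Splus_ub_long hj delta0 aM ph) => //.
  have : n.+2%:R * delta <= 2 * (n.+1%:R * delta).
    by rewrite mulrA ler_pM2r// -natrM ler_nat mul2n -addnn addSn ltnS leq_addl.
  lra.
- move=> sigma sigma0 zeta zeta0.
  have [tau [d [tau0 d0 H]]] := Splus_equicontinuous hj sigma0 zeta0 pu au.
  exists tau, d; split=> //; split=> // delta delta0 _ /massE aM; exact: H.
- move=> delta delta0 /massE aM [//|n] _.
  exact: (totvar_barriers hj delta0 aM n pu au).
Qed.
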